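(* Let $n\ge 1$ be an integer and let $G\subset \mathbf{PU}(n,1)$ be a discrete, torsion-free, non-elementary group acting on complex hyperbolic space $\mathbf{H}^n_{\mathbf{C}}$ with Bergman distance $\rho$. Then there exists a point $o\in \mathbf{H}^n_{\mathbf{C}}$ such that for every $f\in G$ with $f\neq \mathrm{Id}$, $$\rho\big(o,f(o)\big)\ \ge\ \delta,\qquad \text{where } \delta=\frac{0.02}{17^{\,n-1}}.$$
   Context: $\mathbf{C}^{n,1}$ denotes $\mathbf{C}^{n+1}$ with the Hermitian form $\langle \mathbf{z},\mathbf{w}\rangle = z_1\overline{w_1}+\cdots+z_n\overline{w_n}-z_{n+1}\overline{w_{n+1}}$. Complex hyperbolic space $\mathbf{H}^n_{\mathbf{C}}$ is the image in $\mathbf{CP}^n$ of $\{\mathbf{z}:\langle \mathbf{z},\mathbf{z}\rangle<0\}$; normalizing $z_{n+1}=1$ identifies it with the unit ball of $\mathbf{C}^n$. The boundary $\partial\mathbf{H}^n_{\mathbf{C}}$ is the image of the nonzero null vectors, i.e. the unit sphere $S^{2n-1}$. The Bergman distance $\rho$ is normalized by $$\cosh^2\Big(\frac{\rho(x,y)}{2}\Big)=\frac{\langle \mathbf{x},\mathbf{y}\rangle\langle \mathbf{y},\mathbf{x}\rangle}{\langle \mathbf{x},\mathbf{x}\rangle\langle \mathbf{y},\mathbf{y}\rangle},$$ where $\mathbf{x},\mathbf{y}$ are any lifts of $x,y$ to $\mathbf{C}^{n,1}$. $\mathbf{U}(n,1)$ is the group of linear maps preserving the form, and $\mathbf{PU}(n,1)=\mathbf{U}(n,1)/\mathbf{U}(1)$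 (quotient by unit scalars) acts on $\mathbf{H}^n_{\mathbf{C}}$ by holomorphic isometries. A subgroup $G$ is discrete if the identity is isolated in $G$. The limit set $L(G)$ of a discrete group $G$ is the set of accumulation points of the orbit $G(x)$ of an arbitrary point $x$ of the ball (in the closed ball). A discrete group $G$ is called elementary if $|L(G)|<2$, and non-elementary otherwise. *)

(* Defs.v *)
From HB Require Import structures.
From mathcomp Require Import all_boot all_order all_algebra.
From mathcomp Require Import all_classical all_reals all_analysis.
From mathcomp Require Import complex ring.

Set Implicit Arguments.
Unset Strict Implicit.
Unset Printing Implicit Defensive.

Import Order.TTheory GRing.Theory Num.Theory.
Import numFieldNormedType.Exports.

Local Open Scope classical_set_scope.
Local Open Scope card_scope.
Local Open Scope quotient_scope.
Local Open Scope ring_scope.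

(* The usual topology of the complex numbers R[i]; the topology of vectors and
   matrices over R[i] is then the one of the library. *)
HB.instance Definition _ (R : realType) := NormedModule.copy R[i] R[i]^o.

Section Form.
Variables (R : realType) (n : nat).
Local Notation C := R[i].
Local Notation vec := 'cV[C]_(n + 1).

Definition herm (z w : vec) : C :=
  \sum_(i < n) z (lshift 1 i) 0 * (w (lshift 1 i) 0)^*
  - z (rshift n 0) 0 * (w (rshift n 0) 0)^*.

Definition hermJ : 'M[C]_(n + 1) := block_mx 1%:M 0 0 (- 1%:M).

Lemma hermE z w : herm z w = (z^T *m hermJ *m map_mx Num.conj w) 0 0.
Proof.
rewrite -[z in RHS]vsubmxK tr_col_mx /hermJ mul_row_block.
rewrite !mulmx0 !mulmx1 add0r addr0 mulmxN mulmx1.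
rewrite -[w in RHS]vsubmxK map_col_mx mul_row_col mxE /herm; congr (_ + _).
  by rewrite mxE; apply: eq_bigr => i _; rewrite !mxE.
by rewrite mulNmx mxE mxE big_ord1 !mxE.
Qed.

Lemma hermJK : hermJ *m hermJ = 1%:M.
Proof.
rewrite /hermJ mulmx_block !(mul0mx, mulmx0, mul1mx, add0r, addr0).
by rewrite mulmxN mulNmx opprK mulmx1 -scalar_mx_block.
Qed.

Lemma herm_conj z w : (herm z w)^* = herm w z.
Proof.
rewrite /herm rmorphB rmorph_sum /= rmorphM /= conjCK; congr (_ - _); last exact: mulrC.
by apply: eq_bigr => i _; rewrite rmorphM /= conjCK mulrC.
Qed.

Lemma hermZ a b z w : herm (a *: z) (b *: w) = a * b^* * herm z w.
Proof.
rewrite /herm mulrBr mulr_sumr !mxE rmorphM mulrACA; congr (_ - _).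
by apply: eq_bigr => i _; rewrite !mxE rmorphM mulrACA.
Qed.

Definition unitary_set : set 'M[C]_(n + 1) :=
  [set A | forall z w, herm (A *m z) (A *m w) = herm z w].

Lemma unitary_set1 : unitary_set 1%:M.
Proof. by move=> z w; rewrite !mul1mx. Qed.

Lemma unitary_setM A B :
  unitary_set A -> unitary_set B -> unitary_set (A *m B).
Proof. by move=> uA uB z w; rewrite -!mulmxA uA uB. Qed.

Lemma unitary_setJ A : unitary_set A ->
  A^T *m hermJ *m map_mx Num.conj A = hermJ.
Proof.
move=> uA; apply/matrixP => i j.
have deltaE (M : 'M[C]_(n + 1)) :
    ((delta_mx i 0 : vec)^T *m M *m map_mx Num.conj (delta_mx j 0 : vec)) 0 0
    = M i j.
  rewrite map_delta_mx trmx_delta -rowE -colE !mxE //.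
have := uA (delta_mx i 0) (delta_mx j 0).
by rewrite !hermE trmx_mul map_mxM !mulmxA -2!(mulmxA (delta_mx i 0)^T) !deltaE.
Qed.

Lemma unitary_unitmx A : unitary_set A -> A \in unitmx.
Proof.
move=> /unitary_setJ/(congr1 (mulmx hermJ)).
rewrite hermJK -mulmxA !mulmxA => /mulmx1_unit[+ _].
by rewrite !unitmx_mul unitmx_tr => /andP[/andP[]].
Qed.

Lemma unitary_setV A : unitary_set A -> unitary_set (invmx A).
Proof.
by move=> uA z w; rewrite -uA !mulmxA mulmxV ?unitary_unitmx// !mul1mx.
Qed.

End Form.

(* The group U(n,1), with the subspace topology. *)
Definition Un1 (R : realType) (n : nat) : Type := set_type (@unitary_set R n).

HB.instance Definition _ R n := SubType.on (@Un1 R n).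
HB.instance Definition _ R n := Topological.on (@Un1 R n).

Section Un1.
Variables (R : realType) (n : nat).
Local Notation U := (Un1 R n).

Definition Un1_mx (A : U) : 'M[R[i]]_(n + 1) := set_val A.

Lemma Un1P (A : U) : unitary_set (Un1_mx A).
Proof. exact: set_valP. Qed.

Lemma Un1_inj : injective Un1_mx.
Proof. exact: val_inj. Qed.

Definition mkUn1 (A : 'M[R[i]]_(n + 1)) (uA : unitary_set A) : U :=
  SigSub (mem_set uA).

Definition Un1_one : U := mkUn1 (@unitary_set1 R n).
Definition Un1_mul (A B : U) : U := mkUn1 (unitary_setM (Un1P A) (Un1P B)).
Definition Un1_inv (A : U) : U := mkUn1 (unitary_setV (Un1P A)).

Lemma Un1_mulA : associative Un1_mul.
Proof. by move=> A B D; apply: Un1_inj; exact: mulmxA. Qed.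
Lemma Un1_mul1 : left_id Un1_one Un1_mul.
Proof. by move=> A; apply: Un1_inj; exact: mul1mx. Qed.
Lemma Un1_1mul : right_id Un1_one Un1_mul.
Proof. by move=> A; apply: Un1_inj; exact: mulmx1. Qed.
Lemma Un1_mulV : left_inverse Un1_one Un1_inv Un1_mul.
Proof.
by move=> A; apply: Un1_inj; exact/mulVmx/unitary_unitmx/Un1P.
Qed.
Lemma Un1_Vmul : right_inverse Un1_one Un1_inv Un1_mul.
Proof.
by move=> A; apply: Un1_inj; exact/mulmxV/unitary_unitmx/Un1P.
Qed.

HB.instance Definition _ := isGroup.Build U
  Un1_mulA Un1_mul1 Un1_1mul Un1_mulV Un1_Vmul.

Lemma Un1_mxM (A B : U) : Un1_mx (A * B)%g = Un1_mx A *m Un1_mx B.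
Proof. by []. Qed.
Lemma Un1_mx1 : Un1_mx 1%g = 1%:M.
Proof. by []. Qed.
Lemma Un1_mxV (A : U) : Un1_mx A^-1%g = invmx (Un1_mx A).
Proof. by []. Qed.

(* Two elements of U(n,1) are identified in PU(n,1) when they differ by a
   unit scalar. *)
Definition scal_rel : rel U :=
  fun A B => `[< exists2 c : R[i], `|c| = 1 & Un1_mx B = c *: Un1_mx A >].

Lemma scal_rel_refl : reflexive scal_rel.
Proof. by move=> A; apply/asboolP; exists 1; rewrite ?normr1 ?scale1r. Qed.

Lemma scal_rel_sym : symmetric scal_rel.
Proof.
have H A B : scal_rel A B -> scal_rel B A.
  move=> /asboolP[c c1 BA]; apply/asboolP; exists c^-1.
    by rewrite normfV c1 invr1.
  by rewrite BA scalerA mulVf ?scale1r// -normr_eq0 c1 oner_eq0.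
by move=> A B; apply/idP/idP; exact: H.
Qed.

Lemma scal_rel_trans : transitive scal_rel.
Proof.
move=> B A D /asboolP[c c1 BA] /asboolP[d d1 DB]; apply/asboolP.
by exists (d * c); rewrite ?normrM ?c1 ?d1 ?mulr1// DB BA scalerA.
Qed.

Canonical scal_equiv :=
  EquivRel scal_rel scal_rel_refl scal_rel_sym scal_rel_trans.

End Un1.

(* The group PU(n,1) = U(n,1)/U(1), with the quotient topology. *)
Definition PUn1 (R : realType) (n : nat) : Type :=
  quotient_topology {eq_quot (@scal_equiv R n)}.

HB.instance Definition _ R n := Quotient.on (@PUn1 R n).
HB.instance Definition _ R n := Topological.on (@PUn1 R n).

Section PUn1.
Variables (R : realType) (n : nat).
Local Notation U := (Un1 R n).
Local Notation PU := (PUn1 R n).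

Definition PUn1_pi (A : U) : PU := \pi_PU A.
Definition PUn1_repr (f : PU) : U := repr f.

Lemma PUn1_reprK : cancel PUn1_repr PUn1_pi.
Proof. exact: reprK. Qed.

Lemma PUn1_eqP (A B : U) : PUn1_pi A = PUn1_pi B <->
  exists2 c : R[i], `|c| = 1 & Un1_mx B = c *: Un1_mx A.
Proof.
split=> [AB|AB]; last exact/eqmodP/asboolP.
by have /eqmodP/asboolP : \pi_({eq_quot (@scal_equiv R n)}) A = \pi B := AB.
Qed.

Lemma PUn1_repr_pi (A : U) :
  exists2 c : R[i], `|c| = 1 & Un1_mx (PUn1_repr (PUn1_pi A)) = c *: Un1_mx A.
Proof. by apply/PUn1_eqP; rewrite PUn1_reprK. Qed.

Definition PUn1_one : PU := PUn1_pi 1%g.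
Definition PUn1_mul (f g : PU) : PU := PUn1_pi (PUn1_repr f * PUn1_repr g)%g.
Definition PUn1_inv (f : PU) : PU := PUn1_pi (PUn1_repr f)^-1%g.

Lemma PUn1_mul_pi A B : PUn1_mul (PUn1_pi A) (PUn1_pi B) = PUn1_pi (A * B)%g.
Proof.
apply/esym/PUn1_eqP.
have [c c1 cA] := PUn1_repr_pi A; have [d d1 dB] := PUn1_repr_pi B.
exists (c * d); first by rewrite normrM c1 d1 mulr1.
by rewrite !Un1_mxM cA dB -scalemxAl -scalemxAr scalerA.
Qed.

Lemma PUn1_inv_pi A : PUn1_inv (PUn1_pi A) = PUn1_pi A^-1%g.
Proof.
apply/esym/PUn1_eqP; have [c c1 cA] := PUn1_repr_pi A.
exists c^-1; first by rewrite normfV c1 invr1.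
have c0 : c \is a GRing.unit by rewrite unitfE -normr_eq0 c1 oner_eq0.
rewrite !Un1_mxV cA invmxZ// -cA; exact/unitary_unitmx/Un1P.
Qed.

Lemma PUn1_mulA : associative PUn1_mul.
Proof.
move=> f g h; rewrite -[f]PUn1_reprK -[g]PUn1_reprK -[h]PUn1_reprK.
by rewrite !PUn1_mul_pi mulgA.
Qed.
Lemma PUn1_mul1f : left_id PUn1_one PUn1_mul.
Proof. by move=> f; rewrite -[f]PUn1_reprK PUn1_mul_pi mul1g. Qed.
Lemma PUn1_mulf1 : right_id PUn1_one PUn1_mul.
Proof. by move=> f; rewrite -[f]PUn1_reprK PUn1_mul_pi mulg1. Qed.
Lemma PUn1_mulVf : left_inverse PUn1_one PUn1_inv PUn1_mul.
Proof. by move=> f; rewrite -[f]PUn1_reprK PUn1_inv_pi PUn1_mul_pi mulVg. Qed.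
Lemma PUn1_mulfV : right_inverse PUn1_one PUn1_inv PUn1_mul.
Proof. by move=> f; rewrite -[f]PUn1_reprK PUn1_inv_pi PUn1_mul_pi mulgV. Qed.

HB.instance Definition _ := isGroup.Build PU
  PUn1_mulA PUn1_mul1f PUn1_mulf1 PUn1_mulVf PUn1_mulfV.

Lemma PUn1_piM A B : PUn1_pi (A * B)%g = (PUn1_pi A * PUn1_pi B)%g.
Proof. exact/esym/PUn1_mul_pi. Qed.
Lemma PUn1_pi1 : PUn1_pi 1%g = 1%g.
Proof. by []. Qed.
Lemma PUn1_piV A : PUn1_pi A^-1%g = (PUn1_pi A)^-1%g.
Proof. exact/esym/PUn1_inv_pi. Qed.

Lemma PUn1_pi_continuous : continuous PUn1_pi.
Proof. exact: pi_continuous. Qed.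

End PUn1.

Section Ball.
Variables (R : realType) (n : nat).
Local Notation C := R[i].
Local Notation vec := 'cV[C]_(n + 1).
Local Notation PU := (PUn1 R n).

Definition lift_pt (z : 'cV[C]_n) : vec := col_mx z (const_mx 1).

Definition proj_pt (v : vec) : 'cV[C]_n := (v (rshift n 0) 0)^-1 *: usubmx v.

(* Complex hyperbolic space in the affine chart z_(n+1) = 1: negative points,
   that is, the open unit ball (see hypE). *)
Definition hyp : set 'cV[C]_n := [set z | herm (lift_pt z) (lift_pt z) < 0].

Lemma herm_lift z w :
  herm (lift_pt z) (lift_pt w) = \sum_i z i 0 * (w i 0)^* - 1.
Proof.
rewrite /herm /lift_pt !col_mxEd !mxE conjC1 mulr1; congr (_ - _).
by apply: eq_bigr => i _; rewrite !col_mxEu.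
Qed.

Lemma hypE z : hyp z <-> \sum_i `|z i 0| ^+ 2 < 1.
Proof.
rewrite /hyp /= herm_lift subr_lt0.
by under [X in _ <-> is_true (X < _)]eq_bigr do rewrite normCK.
Qed.

Lemma lift_proj (v : vec) : v (rshift n 0) 0 != 0 ->
  lift_pt (proj_pt v) = (v (rshift n 0) 0)^-1 *: v.
Proof.
move=> v0; rewrite -[X in _ *: X]vsubmxK scale_col_mx; congr col_mx.
by apply/matrixP => i j; rewrite !ord1 !mxE mulVf.
Qed.

Lemma proj_lift z : proj_pt (lift_pt z) = z.
Proof.
by rewrite /proj_pt /lift_pt col_mxKu col_mxEd mxE invr1 scale1r.
Qed.

Lemma proj_ptZ c v : c != 0 -> proj_pt (c *: v) = proj_pt v.
Proof.
move=> c0; rewrite /proj_pt mxE linearZ /= scalerA invfM mulrAC mulVf//.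
by rewrite mul1r.
Qed.

Lemma herm_last_neq0 (v : vec) : herm v v < 0 -> v (rshift n 0) 0 != 0.
Proof.
move=> v0; apply: contraTneq v0 => vn0; rewrite /herm vn0 mul0r subr0.
have s0 : 0 <= \sum_(i < n) v (lshift 1 i) 0 * (v (lshift 1 i) 0)^*.
  by apply: sumr_ge0 => i _; exact: mul_conjC_ge0.
by apply/negP => /(le_lt_trans s0); rewrite ltxx.
Qed.

(* The action of PU(n,1): z is lifted to (z, 1), transformed by a matrix
   representing the element, and renormalized. By act_pi this does not depend
   on the representative. *)
Definition act (f : PU) (z : 'cV[C]_n) : 'cV[C]_n :=
  proj_pt (Un1_mx (PUn1_repr f) *m lift_pt z).

Lemma act_pi A z : act (PUn1_pi A) z = proj_pt (Un1_mx A *m lift_pt z).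
Proof.
rewrite /act; have [c c1 ->] := PUn1_repr_pi A.
by rewrite -scalemxAl proj_ptZ// -normr_eq0 c1 oner_eq0.
Qed.

Lemma unitary_lift_neq0 (A : Un1 R n) z : hyp z ->
  (Un1_mx A *m lift_pt z) (rshift n 0) 0 != 0.
Proof. by move=> hz; apply: herm_last_neq0; rewrite (Un1P A). Qed.

Lemma act_hyp f z : hyp z -> hyp (act f z).
Proof.
move=> hz; rewrite /hyp /act /= lift_proj ?unitary_lift_neq0//.
rewrite hermZ -normCK (Un1P _) pmulr_rlt0// exprn_gt0// normr_gt0.
by rewrite invr_eq0 unitary_lift_neq0.
Qed.

Lemma act1 z : act 1%g z = z.
Proof. by rewrite -PUn1_pi1 act_pi Un1_mx1 mul1mx proj_lift. Qed.

Lemma actM f g z : hyp z -> act (f * g)%g z = act f (act g z).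
Proof.
move=> hz; rewrite -[f]PUn1_reprK -[g]PUn1_reprK -PUn1_piM !act_pi.
rewrite lift_proj ?unitary_lift_neq0// -scalemxAr proj_ptZ ?mulmxA//.
by rewrite invr_eq0 unitary_lift_neq0.
Qed.

(* The right-hand side of the formula defining the Bergman distance. *)
Definition herm_ratio (x y : vec) : C :=
  herm x y * herm y x / (herm x x * herm y y).

Lemma herm_ratioZ a b x y : a != 0 -> b != 0 ->
  herm_ratio (a *: x) (b *: y) = herm_ratio x y.
Proof.
move=> a0 b0; rewrite /herm_ratio !hermZ.
have a0' : a^* != 0 by rewrite conjC_eq0.
have b0' : b^* != 0 by rewrite conjC_eq0.
have nz : a * a^* * (b * b^*) != 0 by rewrite !mulf_neq0.
rewrite -[RHS]mul1r -(divff nz) mulf_div; congr (_ / _); ring.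
Qed.

Lemma herm_ratio_ge1 (x y : 'cV[C]_n) : hyp x -> hyp y ->
  1 <= herm_ratio (lift_pt x) (lift_pt y).
Proof.
rewrite /hyp /= => hx hy; rewrite /herm_ratio ler_pdivlMr ?nmulr_lgt0// mul1r.
rewrite -(herm_conj (lift_pt x) (lift_pt y)) -normCK.
move: hx hy; rewrite !herm_lift !subr_lt0.
set a := \sum_i x i 0 * _; set b := \sum_i y i 0 * _; set c := \sum_i _.
move=> a1 b1.
have a0 : 0 <= a by apply: sumr_ge0 => i _; exact: mul_conjC_ge0.
have b0 : 0 <= b by apply: sumr_ge0 => i _; exact: mul_conjC_ge0.
have dotE (u v : 'cV[C]_n) :
    spectral.dotmx u^T v^T = \sum_i u i 0 * (v i 0)^*.
  by rewrite spectral.dotmxE mxE; apply: eq_bigr => i _; rewrite !mxE.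
have cs : `|c| <= sqrtC a * sqrtC b.
  rewrite /a /b /c -!dotE.
  by have [] := CauchySchwarz_sqrt (@spectral.dotmx C n) x^T y^T.
set s := sqrtC a in cs; set t := sqrtC b in cs.
have s0 : 0 <= s by rewrite sqrtC_ge0.
have t0 : 0 <= t by rewrite sqrtC_ge0.
have s1 : s < 1 by rewrite -sqrtC1 ltr_sqrtC ?nnegrE ?ler01.
have t1 : t < 1 by rewrite -sqrtC1 ltr_sqrtC ?nnegrE ?ler01.
have st1 : s * t <= 1 by rewrite mulr_ile1 ?(ltW s1) ?(ltW t1).
have le1 : 1 - s * t <= `|c - 1|.
  apply: (@le_trans _ _ (1 - `|c|)); first by rewrite lerD2l lerN2.
  by rewrite distrC -[X in X - _ <= _](normr1 C) lerB_dist.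
apply: (@le_trans _ _ ((1 - s * t) ^+ 2)); last first.
  by rewrite ler_pXn2r ?nnegrE ?subr_ge0 ?normr_ge0.
have -> : (a - 1) * (b - 1) = (1 - s * t) ^+ 2 - (s - t) ^+ 2.
  rewrite -(sqrtCK a) -(sqrtCK b) -/s -/t; ring.
rewrite lerBlDr lerDl real_exprn_even_ge0//.
by rewrite rpredB// ger0_real.
Qed.

Definition cosh (t : R) : R := (expR t + expR (- t)) / 2.

(* The nonnegative real r such that cosh^2 (r / 2) = herm_ratio x y; see
   bergmanP and bergman_unique. *)
Definition bergman (x y : 'cV[C]_n) : R :=
  xget 0 [set r | 0 <= r /\
    ((cosh (r / 2) ^+ 2)%:C)%C = herm_ratio (lift_pt x) (lift_pt y)].

Lemma cosh_surj (q : R) : 1 <= q -> exists2 t, 0 <= t & cosh t ^+ 2 = q.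
Proof.
move=> q1; pose s := Num.sqrt q; pose e := s + Num.sqrt (q - 1).
have q0 : 0 <= q by exact: le_trans q1.
have s1 : 1 <= s by rewrite -[1]sqrtr1 ler_wsqrtr.
have e1 : 1 <= e by rewrite -[1]addr0 lerD// sqrtr_ge0.
have e0 : 0 < e by exact: lt_le_trans e1.
have eV : e^-1 = s - Num.sqrt (q - 1).
  apply: (mulfI (lt0r_neq0 e0)); rewrite mulfV ?lt0r_neq0//.
  by rewrite /e mulrC -subr_sqr !sqr_sqrtr ?subr_ge0// opprB addrC subrK.
exists (ln e); first by rewrite ln_ge0.
rewrite /cosh expRN lnK ?posrE// eV /e addrACA subrr addr0 -mulr2n.
by rewrite -[s *+ 2]mulr_natr mulfK// sqr_sqrtr.
Qed.

Lemma bergmanP x y : hyp x -> hyp y -> 0 <= bergman x y /\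
  ((cosh (bergman x y / 2) ^+ 2)%:C)%C = herm_ratio (lift_pt x) (lift_pt y).
Proof.
move=> hx hy; rewrite /bergman; case: xgetP => [r _ //|none].
have ge1 := herm_ratio_ge1 hx hy.
set h := herm_ratio _ _ in ge1 none *.
have hR : h = ((complex.Re h)%:C)%C.
  by rewrite RRe_real// ger0_real// (le_trans _ ge1).
have [t t0 tq] : exists2 t, 0 <= t & cosh t ^+ 2 = complex.Re h.
  by apply: cosh_surj; rewrite -lecR -hR.
have := none (t * 2); case; split; first by rewrite mulr_ge0.
by rewrite mulfK// tq -hR.
Qed.

Lemma cosh_sqr_inj (t u : R) :
  0 <= t -> 0 <= u -> cosh t ^+ 2 = cosh u ^+ 2 -> t = u.
Proof.
have cosh_ge0 v : 0 <= cosh v by rewrite divr_ge0// addr_ge0// expR_ge0.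
move=> t0 u0 /eqP; rewrite eqrXn2// => /eqP.
rewrite /cosh !expRN => /(mulIf _) tu.
have {}tu : expR t + (expR t)^-1 = expR u + (expR u)^-1.
  by apply: tu; rewrite invr_eq0 pnatr_eq0.
have e0 : expR t != 0 by rewrite gt_eqF ?expR_gt0.
have f0 : expR u != 0 by rewrite gt_eqF ?expR_gt0.
have /eqP : (expR t - expR u) * (expR t * expR u - 1) = 0.
  transitivity (expR t * expR u *
      (expR t + (expR t)^-1 - (expR u + (expR u)^-1))); first by field; exact/andP.
  by rewrite tu subrr mulr0.
rewrite mulf_eq0 !subr_eq0 => /orP[/eqP/expR_inj//|].
rewrite -expRD -[X in _ == X]expR0 => /eqP/expR_inj/eqP.
by rewrite paddr_eq0// => /andP[/eqP-> /eqP->].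
Qed.

Lemma bergman_unique x y r : hyp x -> hyp y -> 0 <= r ->
  ((cosh (r / 2) ^+ 2)%:C)%C = herm_ratio (lift_pt x) (lift_pt y) ->
  r = bergman x y.
Proof.
move=> hx hy r0 rE; have [b0 bE] := bergmanP hx hy.
have two0 : (2 : R) != 0 by rewrite pnatr_eq0.
apply: (mulIf (invr_neq0 two0)); apply: cosh_sqr_inj; rewrite ?divr_ge0//.
by apply: complexI; rewrite rE bE.
Qed.

Definition hyp_orbit (G : set PU) (x : 'cV[C]_n) : set 'cV[C]_n :=
  [set act f x | f in G].

(* The limit set computed from the base point x; for a discrete group it does
   not depend on the choice of x in hyp. Accumulation points are taken in C^n;
   they lie in the closed ball since the orbit does. *)
Definition limit_set (G : set PU) (x : 'cV[C]_n) : set 'cV[C]_n :=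
  limit_point (hyp_orbit G x).

Definition subgroup (G : set PU) : Prop := group_closed (mem G).

Definition discrete (G : set PU) : Prop := isolated G 1%g.

Definition torsion_free (G : set PU) : Prop :=
  forall f, G f -> f <> 1%g -> forall k, (0 < k)%N -> (f ^+ k)%g <> 1%g.

(* |L(G)| < 2, with x the base point used to compute L(G). *)
Definition elementary (G : set PU) (x : 'cV[C]_n) : Prop :=
  limit_set G x #<= `I_1.

End Ball.

(* Main.v *)
Require Import Defs.
From mathcomp Require Import all_boot all_order all_algebra.
From mathcomp Require Import all_classical all_reals all_analysis.
From mathcomp Require Import complex ring lra.

Set Implicit Arguments.
Unset Strict Implicit.
Unset Printing Implicit Defensive.

Import Order.TTheory GRing.Theory Num.Theory.
Import numFieldNormedType.Exports.
Import ComplexField.Normc.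

Local Open Scope classical_set_scope.
Local Open Scope ring_scope.

(** Say that an element of [G] is slow at a point [z] of the ball when it moves
    [z] by less than [delta = 0.02 / 17 ^ (n - 1)]. Suppose that every point has
    a slow element other than the identity.

    A nontrivial element of [G] has no fixed point in the ball: it would be
    conjugate to a unitary matrix, whose powers come back close to the identity,
    against discreteness and the absence of torsion ([discrete_no_negative]). It
    therefore has one or two fixed points on the boundary sphere
    ([exists_fixed], [fixes_three]).

    Two elements that are slow at the same [z] have the same boundary fixed
    points ([small_disp_boundary_fix]). Seen from [z], a slow element is a small
    boost followed by a unitary matrix [U] of size [n]. The boundary fixed point
    makes one eigenvalue of [U] close to 1, and Dirichlet's theorem applied to
    the other [n - 1] angles yields an exponent [k <= 17 ^ (n - 1)] for which
    [U ^ k] is close to the identity; meanwhile the boosts have accumulated to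
    at most [0.01] ([near_identity_power]). Commutators of matrices that close to
    the identity are closer still, so that the iterated commutators
    [[a, [a, ..., [a, b]]]] of two such powers converge to the identity
    ([iter_commg_cvg1]) and are trivial from some rank on by discreteness. Going
    back up this sequence, each term preserves the fixed points of [a]
    ([iter_commg_Fix]), and in a torsion-free group this forces [b] to fix them.

    Let [F] be the common boundary fixed points of the elements that are slow at
    the centre, and [xi] a boundary point outside [F]. The radius towards [xi] is
    connected and covered by the open sets where a given element is slow, so all
    the elements that are slow somewhere on the radius have [F] as their fixed
    points ([cover_constant]). An element that fixes a point of [F] and is slow
    near [xi] is bounded by a constant ([margin_bounded]), so discreteness leaves
    finitely many of them ([bounded_finite]). But none of these is slow close
    enough to [xi], which it does not fix ([margin_boundary]). *)

(* [normc] is a match on its argument, which [simpl] would expose. *)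
Arguments normc {R} x : simpl never.

(** * Moduli of complex numbers *)

Section ComplexModulus.
Variable R : realType.
Local Notation C := R[i].

Lemma normc_ge0 (z : C) : 0 <= normc z.
Proof. by case: z => a b; exact: sqrtr_ge0. Qed.

Lemma normcR (x : R) : normc (x%:C)%C = `|x|.
Proof. by rewrite /normc /= expr0n /= addr0 sqrtr_sqr. Qed.

Lemma normc_normr (z : C) : `|z| = ((normc z)%:C)%C.
Proof. by []. Qed.

Lemma normc_conj (z : C) : normc z^* = normc z.
Proof. by apply: complexI; rewrite -!normc_normr norm_conjC. Qed.

Lemma mulc_conj (z : C) : z * z^* = ((normc z ^+ 2)%:C)%C.
Proof. by rewrite -normCK normc_normr rmorphXn. Qed.

Lemma normc_one : normc (1 : C) = 1.
Proof. exact: normc1. Qed.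

Lemma normc_zero : normc (0 : C) = 0.
Proof. exact: normc0. Qed.

Lemma normcX (z : C) k : normc (z ^+ k) = normc z ^+ k.
Proof. by elim: k => [|k IH]; rewrite ?expr0 ?normc_one // !exprS normcM IH. Qed.

Lemma normcN (z : C) : normc (- z) = normc z.
Proof. by apply: complexI; rewrite -!normc_normr normrN. Qed.

Lemma normcD (z w : C) : normc (z + w) <= normc z + normc w.
Proof. by rewrite -lecR rmorphD /=; exact: (@ler_normD _ C). Qed.

Lemma normcB (z w : C) : normc (z - w) <= normc z + normc w.
Proof. by rewrite -[normc w]normcN normcD. Qed.

Lemma normc_distC (z w : C) : normc (z - w) = normc (w - z).
Proof. by rewrite -normcN opprB. Qed.

Lemma normc_sum (I : finType) (F : I -> C) :
  normc (\sum_i F i) <= \sum_i normc (F i).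
Proof.
elim/big_ind2: _ => [|a b c d h1 h2|//]; first by rewrite normc_zero.
exact: le_trans (normcD _ _) (lerD h1 h2).
Qed.

Lemma normc_eq0 (z : C) : (normc z == 0) = (z == 0).
Proof. by apply/eqP/eqP => [/eq0_normc|->]; rewrite ?normc_zero. Qed.

Lemma conjR (x : R) : ((x%:C)%C)^* = ((x%:C)%C) :> C.
Proof. by apply/CrealP/complex_realP; exists x. Qed.

Lemma Re_abs_le (z : C) : `|complex.Re z| <= normc z.
Proof.
case: z => a b /=; rewrite /normc -sqrtr_sqr ler_wsqrtr // lerDl.
exact: sqr_ge0.
Qed.

Lemma Im_abs_le (z : C) : `|complex.Im z| <= normc z.
Proof.
case: z => a b /=; rewrite /normc -sqrtr_sqr ler_wsqrtr // lerDr.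
exact: sqr_ge0.
Qed.

Lemma normc_le_ReIm (z : C) : normc z <= `|complex.Re z| + `|complex.Im z|.
Proof.
case: z => a b /=; have -> : (a +i* b)%C = (a%:C + (0 +i* b))%C.
  by rewrite /GRing.add /= addr0 add0r.
apply: le_trans (normcD _ _) _; rewrite normcR lerD2l /normc expr0n /= add0r.
by rewrite sqrtr_sqr.
Qed.

Lemma Re_le_normc (z : C) : complex.Re z <= normc z.
Proof. exact: le_trans (ler_norm _) (Re_abs_le z). Qed.

End ComplexModulus.

(** * The Euclidean norm and bounds on operator norms *)

Section EuclideanNorm.
Variable R : realType.
Local Notation C := R[i].

Definition dot m (x y : 'cV[C]_m) : C := \sum_i x i 0 * (y i 0)^*.

Definition enorm m (v : 'cV[C]_m) : R := Num.sqrt (\sum_i normc (v i 0) ^+ 2).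

Lemma enorm_ge0 m (v : 'cV[C]_m) : 0 <= enorm v.
Proof. exact: sqrtr_ge0. Qed.

Lemma sqr_enorm m (v : 'cV[C]_m) : enorm v ^+ 2 = \sum_i normc (v i 0) ^+ 2.
Proof. by rewrite sqr_sqrtr // sumr_ge0 // => i _; rewrite sqr_ge0. Qed.

Lemma dotvv m (v : 'cV[C]_m) : dot v v = ((enorm v ^+ 2)%:C)%C.
Proof.
by rewrite sqr_enorm rmorph_sum; apply: eq_bigr => i _; rewrite mulc_conj.
Qed.

Lemma dotC m (x y : 'cV[C]_m) : (dot x y)^* = dot y x.
Proof.
rewrite /dot rmorph_sum /=; apply: eq_bigr => i _.
by rewrite rmorphM /= conjCK mulrC.
Qed.

Lemma dotDl m (x x' y : 'cV[C]_m) : dot (x + x') y = dot x y + dot x' y.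
Proof. by rewrite -big_split; apply: eq_bigr => i _; rewrite mxE mulrDl. Qed.

Lemma dotZl m a (x y : 'cV[C]_m) : dot (a *: x) y = a * dot x y.
Proof. by rewrite mulr_sumr; apply: eq_bigr => i _; rewrite mxE mulrA. Qed.

Lemma dotDr m (x y y' : 'cV[C]_m) : dot x (y + y') = dot x y + dot x y'.
Proof. by rewrite -dotC dotDl rmorphD /= !dotC. Qed.

Lemma dotZr m a (x y : 'cV[C]_m) : dot x (a *: y) = a^* * dot x y.
Proof. by rewrite -dotC dotZl rmorphM /= dotC. Qed.

Lemma enorm0 m : enorm (0 : 'cV[C]_m) = 0.
Proof.
apply/eqP; rewrite -sqrf_eq0 sqr_enorm big1 // => i _.
by rewrite mxE normc_zero expr0n.
Qed.

Lemma normc_le_enorm m (v : 'cV[C]_m) i : normc (v i 0) <= enorm v.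
Proof.
rewrite -ler_sqr ?nnegrE ?normc_ge0 ?enorm_ge0 // sqr_enorm (bigD1 i) //=.
by rewrite lerDl sumr_ge0 // => j _; rewrite sqr_ge0.
Qed.

Lemma enorm_eq0 m (v : 'cV[C]_m) : (enorm v == 0) = (v == 0).
Proof.
apply/eqP/eqP => [v0|->]; last exact: enorm0.
apply/colP => i; rewrite mxE; apply: eq0_normc; apply/eqP.
by rewrite eq_le normc_ge0 -v0 normc_le_enorm.
Qed.

Lemma enormZ m a (v : 'cV[C]_m) : enorm (a *: v) = normc a * enorm v.
Proof.
apply/eqP; rewrite -(@eqrXn2 _ 2) ?mulr_ge0 ?enorm_ge0 ?normc_ge0 //.
rewrite exprMn !sqr_enorm mulr_sumr; apply/eqP/eq_bigr => i _.
by rewrite mxE normcM exprMn.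
Qed.

Lemma enormN m (v : 'cV[C]_m) : enorm (- v) = enorm v.
Proof. by rewrite -scaleN1r enormZ normcN normc_one mul1r. Qed.

Lemma real_CauchySchwarz (I : finType) (a b : I -> R) :
  \sum_i a i * b i <=
    Num.sqrt (\sum_i a i ^+ 2) * Num.sqrt (\sum_i b i ^+ 2).
Proof.
have [A0 B0] : 0 <= \sum_i a i ^+ 2 /\ 0 <= \sum_i b i ^+ 2.
  by split; apply: sumr_ge0 => i _; exact: sqr_ge0.
have sA := sqr_sqrtr A0; have sB := sqr_sqrtr B0.
set A := Num.sqrt _ in sA *; set B := Num.sqrt _ in sB *.
have An : 0 <= A by exact: sqrtr_ge0.
have Bn : 0 <= B by exact: sqrtr_ge0.
have zero (c d : I -> R) : \sum_i c i ^+ 2 = 0 -> \sum_i c i * d i = 0.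
  move=> c0; apply: big1 => i _; apply/eqP; rewrite mulf_eq0.
  have /psumr_eq0P/(_ c0)/(_ i isT)/eqP : forall i, true -> 0 <= c i ^+ 2.
    by move=> j _; exact: sqr_ge0.
  by rewrite sqrf_eq0 => ->.
have [AB0|AB0] := eqVneq (A * B) 0.
  move: AB0 => /eqP; rewrite mulf_eq0 => /orP[] /eqP z0.
    by rewrite zero ?mulr_ge0 // -sA z0 expr0n.
  under eq_bigr do rewrite mulrC.
  by rewrite zero ?mulr_ge0 // -sB z0 expr0n.
have ABp : 0 < A * B by rewrite lt_def AB0 mulr_ge0.
rewrite -(ler_pM2l ABp).
have : 0 <= \sum_i (a i * B - b i * A) ^+ 2.
  by apply: sumr_ge0 => i _; exact: sqr_ge0.
have -> : \sum_i (a i * B - b i * A) ^+ 2 =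
    B ^+ 2 * \sum_i a i ^+ 2 + A ^+ 2 * (\sum_i b i ^+ 2)
    - 2 * (A * B * \sum_i a i * b i).
  rewrite !mulr_sumr -sumrN -!big_split /=.
  by apply: eq_bigr => i _; ring.
rewrite -sA -sB; lra.
Qed.

Lemma CauchySchwarz_dot m (x y : 'cV[C]_m) :
  normc (dot x y) <= enorm x * enorm y.
Proof.
apply: le_trans (normc_sum _) _.
under eq_bigr do rewrite normcM normc_conj.
exact: real_CauchySchwarz.
Qed.

Lemma enormD m (x y : 'cV[C]_m) : enorm (x + y) <= enorm x + enorm y.
Proof.
rewrite -ler_sqr ?nnegrE ?addr_ge0 ?enorm_ge0 //.
have : dot (x + y) (x + y) = dot x x + dot y y + (dot x y + (dot x y)^*).
  by rewrite dotDl !dotDr dotC; ring.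
rewrite !dotvv => /(congr1 (@complex.Re R)); rewrite !raddfD /= => ->.
have := Re_le_normc (dot x y); have := CauchySchwarz_dot x y.
have -> : complex.Re (dot x y)^* = complex.Re (dot x y) by case: (dot x y).
rewrite sqrrD; set p := enorm x; set q := enorm y; set r := complex.Re _.
by move=> h1 h2; rewrite mulr2n; lra.
Qed.

Lemma enormB m (x y : 'cV[C]_m) : enorm (x - y) <= enorm x + enorm y.
Proof. by rewrite -[enorm y]enormN enormD. Qed.

Lemma sqr_enorm_col_mx m p (a : 'cV[C]_m) (b : 'cV[C]_p) :
  enorm (col_mx a b) ^+ 2 = enorm a ^+ 2 + enorm b ^+ 2.
Proof.
rewrite !sqr_enorm big_split_ord /=.
by congr (_ + _); apply: eq_bigr => i _; rewrite ?col_mxEu ?col_mxEd.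
Qed.

Lemma enorm_scalar (b : 'cV[C]_1) : enorm b = normc (b 0 0).
Proof.
apply/eqP; rewrite -(@eqrXn2 _ 2) ?enorm_ge0 ?normc_ge0 //.
by rewrite sqr_enorm big_ord1.
Qed.

(** The operator norm of [A] is at most [c]; a relation spares the supremum. *)
Definition opbound m (A : 'M[C]_m) (c : R) :=
  forall v, enorm (A *m v) <= c * enorm v.

Lemma opbound1 m : opbound (1%:M : 'M[C]_m) 1.
Proof. by move=> v; rewrite mul1mx mul1r. Qed.

Lemma opboundW m (A : 'M[C]_m) c d : c <= d -> opbound A c -> opbound A d.
Proof.
move=> cd hA v; apply: le_trans (hA v) _.
by rewrite ler_wpM2r ?enorm_ge0.
Qed.

Lemma opboundM m (A B : 'M[C]_m) c d :
  0 <= c -> opbound A c -> opbound B d -> opbound (A *m B) (c * d).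
Proof.
move=> c0 hA hB v; rewrite -mulmxA; apply: le_trans (hA _) _.
by rewrite -mulrA ler_wpM2l.
Qed.

Lemma opboundD m (A B : 'M[C]_m) c d :
  opbound A c -> opbound B d -> opbound (A + B) (c + d).
Proof.
move=> hA hB v; rewrite mulmxDl mulrDl.
exact: le_trans (enormD _ _) (lerD (hA v) (hB v)).
Qed.

Lemma opboundN m (A : 'M[C]_m) c : opbound A c -> opbound (- A) c.
Proof. by move=> hA v; rewrite mulNmx enormN. Qed.

Lemma opboundB m (A B : 'M[C]_m) c d :
  opbound A c -> opbound B d -> opbound (A - B) (c + d).
Proof. by move=> hA hB; apply: opboundD => //; exact: opboundN. Qed.

Lemma opboundZ m (A : 'M[C]_m) a c :
  opbound A c -> opbound (a *: A) (normc a * c).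
Proof.
move=> hA v; rewrite -scalemxAl enormZ -mulrA ler_wpM2l ?normc_ge0 //.
Qed.

Lemma opbound_entry m (A : 'M[C]_m) c i j :
  opbound A c -> normc (A i j) <= c.
Proof.
move=> /(_ (delta_mx j 0)); rewrite -colE.
have -> : enorm (delta_mx j 0 : 'cV[C]_m) = 1.
  apply/eqP; rewrite -(@eqrXn2 _ 2) ?enorm_ge0 // sqr_enorm.
  rewrite (bigD1 j) //= big1 => [|k /negPf kj]; rewrite !mxE ?eqxx /=.
 by rewrite addr0 normc_one.
  by rewrite kj normc_zero expr0n.
rewrite mulr1; apply: le_trans.
by have := normc_le_enorm (col j A) i; rewrite mxE.
Qed.

Lemma eigenvalue_opbound m (A : 'M[C]_m) c (v : 'cV[C]_m) a :
  opbound A c -> v != 0 -> A *m v = a *: v -> normc a <= c.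
Proof.
move=> hA v0 Av; have := hA v; rewrite Av enormZ ler_pM2r //.
by rewrite lt_def enorm_eq0 v0 enorm_ge0.
Qed.

Lemma enorm_le_sum m (v : 'cV[C]_m) : enorm v <= \sum_i normc (v i 0).
Proof.
have s0 : 0 <= \sum_i normc (v i 0) by apply: sumr_ge0 => i _; exact: normc_ge0.
rewrite -ler_sqr ?nnegrE ?enorm_ge0 // sqr_enorm [leRHS]expr2 mulr_suml.
apply: ler_sum => i _; rewrite expr2 ler_wpM2l ?normc_ge0 //.
rewrite (bigD1 i) //= lerDl; apply: sumr_ge0 => j _; exact: normc_ge0.
Qed.

Lemma entry_opbound m (M : 'M[C]_m) e :
  (forall i j, normc (M i j) <= e) -> opbound M (m%:R * (m%:R * e)).
Proof.
move=> hM v; apply: le_trans (enorm_le_sum _) _.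
apply: (@le_trans _ _ (\sum_(i < m) m%:R * e * enorm v)); last first.
  by rewrite sumr_const card_ord -[leLHS]mulr_natl !mulrA.
apply: ler_sum => i _; rewrite mxE; apply: le_trans (normc_sum _) _.
apply: (@le_trans _ _ (\sum_(j < m) e * enorm v)); last first.
  by rewrite sumr_const card_ord -[leLHS]mulr_natl !mulrA.
apply: ler_sum => j _; rewrite normcM ler_pM ?normc_ge0 //.
exact: normc_le_enorm.
Qed.

End EuclideanNorm.

(** * Simultaneous approximation on the circle *)

Section CirclePigeonhole.
Variable R : realType.
Local Notation C := R[i].

Lemma ndecr_of_derive (f df : R -> R) (a b : R) : a <= b ->
  (forall x : R, is_derive x 1 f (df x)) ->
  (forall x, a <= x -> 0 <= df x) -> f a <= f b.
Proof.
move=> ab dfE df0; have [|c cab E] := @MVT_segment R f df a b ab (fun x _ => dfE x).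
  apply: continuous_subspaceT => y.
  apply: differentiable_continuous; apply/derivable1_diffP.
  by have [] := dfE y.
move: cab; rewrite in_itv /= => /andP[ac _].
by rewrite -subr_ge0 E; apply: mulr_ge0; [exact: df0|rewrite subr_ge0].
Qed.

Lemma sin_le_id (x : R) : 0 <= x -> sin x <= x.
Proof.
move=> x0; have : 0 - sin 0 <= x - sin x.
  by apply: (@ndecr_of_derive (id - sin) (fun x => 1 - cos x)).
by rewrite sin0 subr0 subr_ge0.
Qed.

Lemma cos_ge_taylor (x : R) : 0 <= x -> 1 - x ^+ 2 / 2 <= cos x.
Proof.
move=> x0; pose f y : R := cos y + 2^-1 *: y ^+ 2.
have : f 0 <= f x.
  apply: (@ndecr_of_derive f (fun x => x - sin x)) => // [y|y y0].
    apply: is_derive_eq.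
    by rewrite /GRing.scale /=; field.
  by rewrite /= subr_ge0 sin_le_id.
rewrite /f cos0 expr0n /= scaler0 addr0 [_ *: _]mulrC; lra.
Qed.

Lemma sin_ge_taylor (x : R) : 0 <= x -> x - x ^+ 3 / 6 <= sin x.
Proof.
move=> x0; pose f y : R := sin y - y + 6^-1 *: y ^+ 3.
have : f 0 <= f x.
  apply: (@ndecr_of_derive f (fun x => cos x - 1 + x ^+ 2 / 2)) => // [y|y y0].
    apply: is_derive_eq.
    by rewrite /GRing.scale /=; field.
  by have := cos_ge_taylor y0; lra.
rewrite /f sin0 expr0n /= scaler0 [_ *: _]mulrC; lra.
Qed.

(** [pi / 6] is a root of [cos (3 * y) = cos y * (1 - 4 * sin y ^+ 2)]. *)
Lemma sin_pi6 : sin (pi / 6 : R) = 1 / 2.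
Proof.
set y : R := pi / 6; have pi0 := pi_gt0 R.
have c3 : cos (y + (y + y)) = 0.
  by rewrite -(cos_pihalf R); congr cos; rewrite /y; field.
have cy : 0 < cos y by apply: cos_gt0_pihalf; rewrite /y; apply/andP; split; lra.
have sy : 0 < sin y by apply: sin_gt0_pihalf; rewrite /y; apply/andP; split; lra.
have : cos y * (1 - 2 * sin y) * (1 + 2 * sin y) = 0.
  rewrite -c3 !cosD sinD.
  transitivity (cos y * cos y ^+ 2 - 3 * cos y * sin y ^+ 2); last by ring.
  by rewrite cos2sin2; ring.
move=> /eqP; rewrite !mulf_eq0 (gt_eqF cy) /= => /orP[]/eqP E; lra.
Qed.

(** The cubic Taylor bound puts [sin (525 / 1000)] above [sin (pi / 6)]. *)
Lemma pi_lt_315 : (pi : R) < 315 / 100.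
Proof.
rewrite ltNge; apply/negP => h; have pi0 := pi_gt0 R.
have t := @sin_ge_taylor (525 / 1000) ltac:(lra).
have : sin (525 / 1000 : R) <= sin (pi / 6).
  rewrite leNgt ltr_sin ?in_itv /=; first by rewrite -leNgt; lra.
    by apply/andP; split; lra.
  by apply/andP; split; lra.
rewrite sin_pi6; lra.
Qed.

Lemma unit_circle_angle (z : C) : normc z = 1 ->
  exists2 t : R, - pi <= t <= pi & z = (cos t +i* sin t)%C.
Proof.
case: z => a b; rewrite /normc => /eqP.
rewrite -[X in _ == X]sqrtr1 eqr_sqrt ?addr_ge0 ?sqr_ge0 ?ler01 // => /eqP ab1.
have a1 : -1 <= a <= 1.
  rewrite -ler_norml -(@ler_pXn2r _ 2) ?nnegrE // expr1n real_normK ?num_real //.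
  by rewrite -ab1 lerDl sqr_ge0.
have [b0|b0] := leP 0 b.
  exists (acos a).
    by rewrite acos_lepi // andbT (le_trans _ (acos_ge0 a1)) // oppr_le0 pi_ge0.
  rewrite acosK ?in_itv // sin_acos //; congr (_ +i* _)%C.
  have -> : 1 - a ^+ 2 = b ^+ 2 by rewrite -ab1; ring.
  by rewrite sqrtr_sqr ger0_norm.
exists (- acos a).
  by rewrite lerN2 acos_lepi //= (le_trans _ (pi_ge0 R)) // oppr_le0 acos_ge0.
rewrite cosN sinN acosK ?in_itv // sin_acos //; congr (_ +i* _)%C.
have -> : 1 - a ^+ 2 = b ^+ 2 by rewrite -ab1; ring.
by rewrite sqrtr_sqr ltr0_norm ?opprK.
Qed.

Lemma chord_le_arc (s t : R) :
  normc ((cos s +i* sin s)%C - (cos t +i* sin t)%C) <= `|s - t|.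
Proof.
rewrite -ler_sqr ?nnegrE ?normc_ge0 // real_normK ?num_real //.
rewrite /normc /= sqr_sqrtr ?addr_ge0 ?sqr_ge0 //.
have := @cos_ge_taylor `|s - t| (normr_ge0 _).
rewrite cos_norm real_normK ?num_real // cosB.
have := cos2Dsin2 s; have := cos2Dsin2 t; lra.
Qed.

(** Arcs of angle [63 / 10 / N.+1]: as [63 / 10] is larger than [2 * pi], the index
    of the last arc stays below [N.+1]. *)
Lemma circle_cells (N : nat) : exists cell : C -> 'I_N.+1,
  forall z w, normc z = 1 -> normc w = 1 -> cell z = cell w ->
    normc (z - w) <= 63 / 10 / N.+1%:R.
Proof.
pose arg z : R := xget 0 [set t | - pi <= t <= pi /\ z = (cos t +i* sin t)%C].
have argP z : normc z = 1 ->
    - pi <= arg z <= pi /\ z = (cos (arg z) +i* sin (arg z))%C.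
  rewrite /arg => /unit_circle_angle[t ht zt].
  by case: xgetP => [r _ //|/(_ t)[]].
pose M : R := N.+1%:R; have M0 : 0 < M by rewrite ltr0n.
pose u z : R := (arg z + pi) / (63 / 10) * M.
have u_itv z : normc z = 1 -> 0 <= u z < M.
  move=> /argP[/andP[h1 h2] _]; have := pi_lt_315.
  rewrite /u => pi315; apply/andP; split.
    by rewrite mulr_ge0 ?(ltW M0) // divr_ge0 //; lra.
  rewrite -ltr_pdivlMr // divff ?gt_eqF // ltr_pdivrMr; lra.
exists (fun z => inord (Num.truncn (u z))) => z w z1 w1 /(congr1 val) /=.
have cellE y : normc y = 1 ->
    (inord (Num.truncn (u y)) : 'I_N.+1) = Num.truncn (u y) :> nat.
  move=> /u_itv /andP[h0 h1].
  rewrite inordK // -[(_ < _)%N]/(Num.truncn (u y) < N.+1)%N.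
  by rewrite truncn_lt_nat.
rewrite !cellE // => E.
have [_ zE] := argP _ z1; have [_ wE] := argP _ w1.
have /andP[a0 a1] := truncn_itv (proj1 (andP (u_itv _ z1))).
have /andP[b0 b1] := truncn_itv (proj1 (andP (u_itv _ w1))).
rewrite E in a0 a1.
rewrite zE wE; apply: le_trans (chord_le_arc _ _) _.
have uE : arg z - arg w = (u z - u w) * (63 / 10 / M).
  by rewrite /u; field; rewrite gt_eqF.
have k0 : 0 <= 63 / 10 / M by rewrite divr_ge0 ?(ltW M0) //; lra.
rewrite uE normrM (ger0_norm k0) ler_piMl //.
by rewrite ler_norml; rewrite -natr1 in a1 b1; apply/andP; split; lra.
Qed.

(** Dirichlet's theorem: among the powers [0, ..., N.+1 ^ m] two fall in the same
    product of arcs. *)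
Lemma simultaneous_approximation m (N : nat) (l : 'I_m -> C) :
  (forall i, normc (l i) = 1) -> exists k, (0 < k <= N.+1 ^ m)%N /\
    forall i, normc (l i ^+ k - 1) <= 63 / 10 / N.+1%:R.
Proof.
move=> l1; have [cell cellP] := circle_cells N.
pose F (j : 'I_(N.+1 ^ m).+1) := [ffun i => cell (l i ^+ j)].
have /injectivePn[j [k jk FE]] : ~~ injectiveb F.
  apply/negP => /injectiveP/leq_card; rewrite card_ffun !card_ord.
  by rewrite ltnn.
wlog lt_jk : j k jk FE / (j < k)%N.
  move=> W; have [lt|lt|/val_inj eq] := ltngtP j k; first exact: (W j k).
    by apply: (W k j); rewrite // eq_sym.
  by rewrite eq eqxx in jk.
exists (k - j)%N; split.
  by rewrite subn_gt0 lt_jk /= (leq_trans (leq_subr _ _)) // -ltnS.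
move=> i; have lX q : normc (l i ^+ q) = 1 by rewrite normcX l1 expr1n.
have := cellP _ _ (lX k) (lX j).
have /ffunP/(_ i) := FE; rewrite !ffunE => -> /(_ erefl).
have -> : l i ^+ k - l i ^+ j = l i ^+ j * (l i ^+ (k - j) - 1).
  by rewrite mulrBr mulr1 -exprD subnKC // ltnW.
by rewrite normcM lX mul1r.
Qed.

End CirclePigeonhole.

(** * Spectrum of unitary matrices *)

Section UnitaryMatrices.
Variable R : realType.
Local Notation C := R[i].
Local Open Scope sesquilinear_scope.

Lemma dotE m (x y : 'cV[C]_m) : dot x y = (y ^t* *m x) 0 0.
Proof. by rewrite mxE; apply: eq_bigr => i _; rewrite !mxE mulrC. Qed.

Lemma dot_unitarymx m (P : 'M[C]_m) (x y : 'cV[C]_m) :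
  P \is unitarymx -> dot (P *m x) (P *m y) = dot x y.
Proof.
move=> /unitarymxP/mulmx1C PP.
by rewrite !dotE trmx_mul map_mxM !mulmxA -(mulmxA _ _ P) PP mulmx1.
Qed.

Lemma enorm_dot m (x y : 'cV[C]_m) : dot x x = dot y y -> enorm x = enorm y.
Proof.
rewrite !dotvv => /complexI/eqP.
by rewrite eqrXn2 ?enorm_ge0 // => /eqP.
Qed.

Lemma enorm_unitarymx m (P : 'M[C]_m) (x : 'cV[C]_m) :
  P \is unitarymx -> enorm (P *m x) = enorm x.
Proof. by move=> uP; apply: enorm_dot; rewrite dot_unitarymx. Qed.

Lemma dot_isometry_unitarymx m (U : 'M[C]_m) :
  (forall x y : 'cV[C]_m, dot (U *m x) (U *m y) = dot x y) -> U \is unitarymx.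
Proof.
move=> hU; rewrite -trmxC_unitary; apply/unitarymxP; rewrite trmxCK.
apply/matrixP => i j.
have := hU (delta_mx j 0) (delta_mx i 0).
rewrite !dotE trmx_mul map_mxM trmx_delta map_delta_mx /=.
rewrite -mulmxA [U ^t* *m _]mulmxA.
rewrite -!rowE -colE [in LHS]mxE [in LHS]mxE => ->.
by rewrite !mxE eqxx andbT eq_sym.
Qed.

(** The spectral theorem, in the form used below: the distance of [U ^+ k] to the
    identity is read off the eigenvalues, and an almost fixed vector forces an
    eigenvalue close to 1. *)
Lemma unitary_spectrum m (U : 'M[C]_m) : U \is unitarymx ->
  exists l : 'I_m -> C, [/\ forall i, normc (l i) = 1,
    forall k c, (forall i, normc (l i ^+ k - 1) <= c) -> opbound (U ^+ k - 1) c
  & forall c x, x != 0 -> enorm (U *m x - x) <= c * enorm x ->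
      exists i, normc (l i - 1) <= c].
Proof.
move=> uU; have nU : U \is normalmx.
  by apply/normalmxP; have /unitarymxP UU := uU; rewrite UU (mulmx1C UU).
have [P [d [uP UE]]] : exists P d, P \is unitarymx /\ U = invmx P *m diag_mx d *m P.
  exists (spectralmx U), (spectral_diag U); split; first exact: spectral_unitarymx.
  exact/orthomx_spectralP.
have P1 := unitarymx_unit uP; set D := diag_mx d in UE; pose l i := d 0 i.
have PU : P *m U = D *m P.
  by rewrite [X in _ *m X]UE -mulmxA (mulKVmx P1).
have PUk k : P *m U ^+ k = D ^+ k *m P.
  elim: k => [|k IH]; first by rewrite !expr0 mulmx1 mul1mx.
  by rewrite !exprSr -!mulmxE mulmxA IH -mulmxA PU mulmxA.
have Dk k : D ^+ k = diag_mx (\row_i l i ^+ k).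
  elim: k => [|k IH].
    rewrite expr0; apply/matrixP => i j; rewrite !mxE expr0.
    by case: eqP.
  rewrite exprS IH -mulmxE; apply/matrixP => i j; rewrite mul_diag_mx !mxE exprS.
  by rewrite mulrnAr.
have DkE k (y : 'cV[C]_m) i :
    ((D ^+ k - 1) *m y) i 0 = (l i ^+ k - 1) * y i 0.
  by rewrite mulmxBl mul1mx Dk mul_diag_mx !mxE mulrBl mul1r.
have UkE k x : enorm ((U ^+ k - 1) *m x) = enorm ((D ^+ k - 1) *m (P *m x)).
  rewrite -(enorm_unitarymx _ uP) mulmxA mulmxBr PUk mulmx1.
  by rewrite mulmxA [in RHS]mulmxBl mul1mx.
exists l; split.
- move=> i; have uD : D \is unitarymx.
    have -> : D = P *m U *m P ^t* by rewrite PU mulmxtVK.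
    apply: mul_unitarymx; [exact: mul_unitarymx uP uU|by rewrite trmxC_unitary].
  have := enorm_unitarymx (delta_mx i 0) uD.
  rewrite -[D]expr1 Dk -colE.
  set e := enorm (delta_mx i 0) => eE.
  have e0 : e != 0.
    rewrite enorm_eq0; apply/negP => /eqP/colP/(_ i)/eqP.
    by rewrite !mxE !eqxx oner_eq0.
  apply: (mulIf e0); rewrite mul1r -[RHS]eE -enormZ; congr enorm.
  apply/colP => j; rewrite !mxE expr1 eqxx andbT.
  by case: eqP => [->|]; rewrite ?mulr1 ?mulr0.
- move=> k c lc x; rewrite UkE -[enorm x](enorm_unitarymx _ uP).
  set y := P *m x.
  have [m0|] := posnP m.
    rewrite (_ : y = 0) ?mulmx0 ?enorm0 ?mulr0 //.
    by apply/matrixP => i; have := leq_trans (ltn_ord i) (eq_leq m0).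
  move=> m0; have c0 : 0 <= c := le_trans (normc_ge0 _) (lc (Ordinal m0)).
  rewrite -ler_sqr ?nnegrE ?mulr_ge0 ?enorm_ge0 // exprMn !sqr_enorm mulr_sumr.
  apply: ler_sum => i _; rewrite DkE normcM exprMn ler_wpM2r ?sqr_ge0 //.
  by rewrite ler_sqr ?nnegrE ?normc_ge0.
- move=> c x x0 hx; apply: contrapT => /forallNP hl.
  have {}hl i : c < normc (l i - 1) by rewrite ltNge; apply/negP/hl.
  have c0 : 0 <= c.
    have xp : 0 < enorm x by rewrite lt_def enorm_eq0 x0 enorm_ge0.
    by rewrite -(pmulr_lge0 _ xp) (le_trans _ hx) ?enorm_ge0.
  move: hx; rewrite -{2}[x]mul1mx -mulmxBl -{1}[U]expr1 UkE.
  rewrite -[enorm x](enorm_unitarymx _ uP); set y := P *m x.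
  have y0 : y != 0 by rewrite -enorm_eq0 enorm_unitarymx // enorm_eq0.
  apply/negP; rewrite -ltNge.
  rewrite -ltr_sqr ?nnegrE ?mulr_ge0 ?enorm_ge0 // exprMn !sqr_enorm mulr_sumr.
  have [i yi] : exists i, y i 0 != 0.
    apply: contrapT => /forallNP yN; move: y0 => /eqP; apply; apply/colP => i.
    by rewrite [RHS]mxE; have /negP := yN i; rewrite negbK => /eqP.
  have hle j : c ^+ 2 * normc (y j 0) ^+ 2 <=
      normc (((D ^+ 1 - 1) *m y) j 0) ^+ 2.
    rewrite DkE normcM exprMn ler_wpM2r ?sqr_ge0 //.
    by rewrite expr1 ler_sqr ?nnegrE ?normc_ge0 ?c0 ?ltW ?hl.
  rewrite (bigD1 i) //= [X in _ < X](bigD1 i) //= ltr_leD ?ler_sum //.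
  have yip : 0 < normc (y i 0) ^+ 2.
    by rewrite exprn_gt0 // lt_def normc_eq0 yi normc_ge0.
  rewrite DkE normcM exprMn ltr_pM2r //.
  by rewrite expr1 ltr_sqr ?nnegrE ?normc_ge0 ?hl.
Qed.

End UnitaryMatrices.

(** * The Hermitian form *)

Section FormGeometry.
Variables (R : realType) (n : nat).
Local Notation C := R[i].
Local Notation vec := 'cV[C]_(n + 1).
Local Notation mat := 'M[C]_(n + 1).
Local Notation cx := (real_complex R).
Local Open Scope sesquilinear_scope.

Definition lst (v : vec) : C := v (rshift n 0) 0.

Definition base : vec := col_mx 0 (const_mx 1).

Lemma vec_split (v : vec) : v = col_mx (usubmx v) (const_mx (lst v)).
Proof.
rewrite -[LHS]vsubmxK; congr col_mx.
by apply/matrixP => i j; rewrite !ord1 !mxE.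
Qed.

Lemma lst_col_mx (a : 'cV[C]_n) b : lst (col_mx a (const_mx b)) = b.
Proof. by rewrite /lst col_mxEd mxE. Qed.

Lemma lstZ a (v : vec) : lst (a *: v) = a * lst v.
Proof. by rewrite /lst mxE. Qed.

Lemma herm_dot (z w : vec) :
  herm z w = dot (usubmx z) (usubmx w) - lst z * (lst w)^*.
Proof. by rewrite /herm; congr (_ - _); apply: eq_bigr => i _; rewrite !mxE. Qed.

Lemma herm_col_mx (a a' : 'cV[C]_n) b b' :
  herm (col_mx a (const_mx b)) (col_mx a' (const_mx b')) = dot a a' - b * b'^*.
Proof. by rewrite herm_dot !col_mxKu !lst_col_mx. Qed.

Lemma hermvv (v : vec) :
  herm v v = cx (enorm (usubmx v) ^+ 2 - normc (lst v) ^+ 2).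
Proof. by rewrite herm_dot dotvv mulc_conj rmorphB. Qed.

Lemma sqr_enorm_split (v : vec) :
  enorm v ^+ 2 = enorm (usubmx v) ^+ 2 + normc (lst v) ^+ 2.
Proof. by rewrite {1}(vec_split v) sqr_enorm_col_mx enorm_scalar mxE. Qed.

Lemma hermDl (x x' y : vec) : herm (x + x') y = herm x y + herm x' y.
Proof.
by rewrite !herm_dot raddfD /= dotDl /lst mxE mulrDl opprD; ring.
Qed.

Lemma hermZl a (x y : vec) : herm (a *: x) y = a * herm x y.
Proof. by rewrite -[y in LHS]scale1r hermZ conjC1 mulr1. Qed.

Lemma hermDr (x y y' : vec) : herm x (y + y') = herm x y + herm x y'.
Proof. by rewrite -herm_conj hermDl rmorphD /= !herm_conj. Qed.

Lemma hermZr a (x y : vec) : herm x (a *: y) = a^* * herm x y.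
Proof. by rewrite -[x in LHS]scale1r hermZ mul1r. Qed.

Lemma herm0l (y : vec) : herm 0 y = 0.
Proof. by rewrite -(scale0r 0) hermZl mul0r. Qed.

Lemma normc_hermC (x y : vec) : normc (herm x y) = normc (herm y x).
Proof. by rewrite -herm_conj normc_conj. Qed.

Lemma herm_base (x : vec) : herm x base = - lst x.
Proof.
rewrite {1}(vec_split x) herm_col_mx conjC1 mulr1.
rewrite -[dot _ _]conjCK dotC (_ : dot 0 _ = 0) ?rmorph0 ?sub0r //.
by apply: big1 => i _; rewrite mxE mul0r.
Qed.

(** * Boosts *)

Definition boostc (q : 'cV[C]_n) : R := Num.sqrt (1 + enorm q ^+ 2).

(** The transvection of U(n,1) that fixes the orthogonal of [q] and of [base]
    and moves [base] to [(q, boostc q)]; on the plane of [q] and [base] it has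
    the eigenvalues [boostc q +- enorm q]. *)
Definition boost (q : 'cV[C]_n) : mat :=
  block_mx (1%:M + cx (1 + boostc q)^-1 *: (q *m q ^t*)) q
           (q ^t*) (cx (boostc q))%:M.

Lemma sqr_boostc q : boostc q ^+ 2 = 1 + enorm q ^+ 2.
Proof. by rewrite sqr_sqrtr // addr_ge0 // sqr_ge0. Qed.

Lemma boostc_ge1 q : 1 <= boostc q.
Proof. by rewrite -[leLHS]sqrtr1 ler_wsqrtr // lerDl sqr_ge0. Qed.

Lemma boostE q (a : 'cV[C]_n) b :
  boost q *m col_mx a (const_mx b) =
  col_mx (a + (dot a q * cx (1 + boostc q)^-1 + b) *: q)
         (const_mx (dot a q + cx (boostc q) * b)).
Proof.
have qa : (q ^t*) *m a = (const_mx (dot a q) : 'M[C]_1).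
  by apply/matrixP => i j; rewrite !ord1 [RHS]mxE dotE.
have qs (x : C) : q *m (const_mx x : 'M[C]_1) = x *: q.
  by apply/matrixP => i j; rewrite (ord1 j) mxE big_ord1 !mxE mulrC.
rewrite /boost mul_block_col mulmxDl mul1mx -scalemxAl -mulmxA qa !qs.
congr col_mx; first by rewrite -addrA scalerA -scalerDl; congr (_ + _ *: _); ring.
by apply/matrixP => i j; rewrite mul_scalar_mx !mxE.
Qed.

Lemma boost_base q : boost q *m base = col_mx q (const_mx (cx (boostc q))).
Proof.
rewrite boostE (_ : dot 0 q = 0); last by apply: big1 => i _; rewrite mxE mul0r.
by rewrite mul0r !add0r scale1r mulr1.
Qed.

Lemma boost_unitary q : unitary_set (boost q).
Proof.
move=> z w; rewrite (vec_split z) (vec_split w).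
set a := usubmx z; set b := lst z; set a' := usubmx w; set b' := lst w.
rewrite !boostE !herm_col_mx !(dotDl, dotDr, dotZl, dotZr) dotvv.
have -> : cx (enorm q ^+ 2) = cx (boostc q) ^+ 2 - 1.
  by rewrite -rmorphXn sqr_boostc rmorphD /= -[cx 1]/(1 : C) addrAC subrr add0r.
have c0 : 1 + cx (boostc q) != 0.
  rewrite -[1]/(cx 1) -rmorphD /= (inj_eq (@complexI R)) gt_eqF //.
  by rewrite addr_gt0 ?ltr01 // (lt_le_trans ltr01) ?boostc_ge1.
rewrite !(rmorphD, rmorphM, fmorphV, rmorph1) /= !conjR !dotC.
move: c0; set c := cx (boostc q) => c0.
field.
exact: c0.
Qed.

(** With [c = boostc q] and [s = enorm q], the pair of norms of the two components
    of [(boost q - 1) (a, b)] is at most the image of the pair of norms of [a] and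
    [b] under the symmetric matrix with diagonal [c - 1] and off-diagonal [s],
    whose largest eigenvalue is [c - 1 + s]. *)
Lemma boost_near1 q : opbound (boost q - 1) (boostc q + enorm q - 1).
Proof.
move=> v; set c := boostc q; set s := enorm q.
have c1 : 1 <= c := boostc_ge1 q.
have s0 : 0 <= s := enorm_ge0 q.
have c2 : c ^+ 2 = 1 + s ^+ 2 := sqr_boostc q.
have k0 : 0 <= c + s - 1 by lra.
rewrite {1}(vec_split v) mulmxBl mul1mx boostE opp_col_mx add_col_mx -/c.
set a := usubmx v; set b := lst v; set d := dot a q.
have -> : a + (d * cx (1 + c)^-1 + b) *: q - a = (d * cx (1 + c)^-1 + b) *: q.
  by rewrite addrAC subrr add0r.
have -> : const_mx (d + cx c * b) - const_mx b =
    const_mx (d + cx (c - 1) * b) :> 'cV[C]_1.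
  by apply/matrixP => i j; rewrite !mxE rmorphB /= rmorph1; ring.
set A := enorm a; set B := normc b.
have A0 : 0 <= A := enorm_ge0 _. have B0 : 0 <= B := normc_ge0 _.
have dle : normc d <= A * s := CauchySchwarz_dot _ _.
have h1 : enorm ((d * cx (1 + c)^-1 + b) *: q) <= (c - 1) * A + s * B.
  rewrite enormZ -/s; have : normc (d * cx (1 + c)^-1 + b) <= A * s / (1 + c) + B.
    apply: le_trans (normcD _ _) _; rewrite lerD2r normcM normcR.
    by rewrite ger0_norm ?invr_ge0 ?ler_wpM2r ?invr_ge0 //; lra.
  move=> /(ler_wpM2r s0) /le_trans; apply.
  rewrite le_eqVlt; apply/orP; left; apply/eqP.
  have -> : c - 1 = s ^+ 2 / (1 + c).
    have cn : 1 + c != 0 by rewrite gt_eqF //; lra.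
    have -> : s ^+ 2 = (c - 1) * (1 + c) by rewrite -[s ^+ 2](addKr 1) -c2; ring.
    by field.
  by ring.
have h2 : normc (d + cx (c - 1) * b) <= s * A + (c - 1) * B.
  apply: le_trans (normcD _ _) _; rewrite normcM normcR ger0_norm; last by lra.
  by rewrite lerD2r mulrC.
rewrite -ler_sqr ?nnegrE ?mulr_ge0 ?enorm_ge0 //.
rewrite sqr_enorm_col_mx enorm_scalar mxE exprMn sqr_enorm_split -/a -/b -/A -/B.
have g1 := enorm_ge0 ((d * cx (1 + c)^-1 + b) *: q).
have g2 := normc_ge0 (d + cx (c - 1) * b).
have hh1 := lerXn2r 2 g1 (le_trans g1 h1) h1.
have hh2 := lerXn2r 2 g2 (le_trans g2 h2) h2.
apply: le_trans (lerD hh1 hh2) _.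
rewrite -subr_ge0.
have -> : (c + s - 1) ^+ 2 * (A ^+ 2 + B ^+ 2) -
   (((c - 1) * A + s * B) ^+ 2 + (s * A + (c - 1) * B) ^+ 2) =
   2 * ((c - 1) * s) * (A - B) ^+ 2 by ring.
by rewrite mulr_ge0 ?sqr_ge0 // mulr_ge0 // mulr_ge0 //; lra.
Qed.

End FormGeometry.

(** * Polar decomposition in U(n,1) *)

Section PolarDecomposition.
Variables (R : realType) (n : nat).
Local Notation C := R[i].
Local Notation vec := 'cV[C]_(n + 1).
Local Notation mat := 'M[C]_(n + 1).
Local Notation cx := (real_complex R).
Local Notation base := (base R n).

Lemma herm_basebase : herm base base = -1.
Proof. by rewrite herm_base lst_col_mx. Qed.

Lemma unitary_set_scale (A : mat) th :
  normc th = 1 -> unitary_set A -> unitary_set (th *: A).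
Proof.
move=> th1 uA z w; rewrite -!scalemxAl hermZ uA mulc_conj th1 expr1n.
by rewrite rmorph1 mul1r.
Qed.

Lemma unit_phase (z : C) : z != 0 ->
  exists2 th : C, normc th = 1 & th * z = cx (normc z).
Proof.
move=> z0; have nz : cx (normc z) != 0.
  by rewrite (inj_eq (@complexI R)) normc_eq0.
exists (z^* / cx (normc z)).
  rewrite normcM normc_conj normcV normcR ger0_norm ?normc_ge0 // divff //.
  by rewrite normc_eq0.
rewrite mulrAC [_ * z]mulrC mulc_conj rmorphXn /= expr2.
by rewrite -mulrA divff ?mulr1.
Qed.

Lemma sqr_lst_base (A : mat) : unitary_set A ->
  normc (lst (A *m base)) ^+ 2 = 1 + enorm (usubmx (A *m base)) ^+ 2.
Proof.
move=> uA; have := uA base base; rewrite herm_basebase hermvv.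
rewrite -[-1]/(- cx 1) -rmorphN => /complexI; lra.
Qed.

Lemma lst_base_ge1 (A : mat) : unitary_set A -> 1 <= normc (lst (A *m base)).
Proof.
move=> uA; rewrite -(@ler_pXn2r _ 2) ?nnegrE ?normc_ge0 // expr1n.
by rewrite sqr_lst_base // lerDl sqr_ge0.
Qed.

Lemma lst_base_boostc (A : mat) : unitary_set A ->
  normc (lst (A *m base)) = boostc (usubmx (A *m base)).
Proof.
move=> uA; rewrite /boostc -sqr_lst_base // sqrtr_sqr ger0_norm //.
exact: normc_ge0.
Qed.

(** The last coordinate of [v] is [- herm v base], hence is preserved by [W], and
    so is the complement of [base], on which the form is Euclidean. *)
Lemma stabilizer_block (W : mat) : unitary_set W -> W *m base = base ->
  exists2 U : 'M[C]_n, U \is unitarymx & W = block_mx U 0 0 1%:M.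
Proof.
move=> uW Wb.
have lstW v : lst (W *m v) = lst v.
  by apply: oppr_inj; rewrite -!herm_base -{1}Wb uW.
pose U := ulsubmx W.
have WU (a : 'cV[C]_n) : W *m col_mx a 0 = col_mx (U *m a) 0.
  rewrite -{1}[W]submxK mul_block_col !mulmx0 !addr0; congr col_mx.
  have := lstW (col_mx a 0); rewrite -{1}[W]submxK mul_block_col !mulmx0 !addr0.
  rewrite /lst !col_mxEd => E; apply/matrixP => i j; rewrite !ord1 E.
  by rewrite !mxE.
have WE : W = block_mx U 0 0 1%:M.
  have : W *m base = base by [].
  rewrite -{1}[W]submxK /base mul_block_col !mulmx0 !add0r => /eq_col_mx[h1 h2].
  have one : const_mx 1 = 1%:M :> 'M[C]_1.
    by apply/matrixP => i j; rewrite !ord1 !mxE.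
  rewrite one !mulmx1 in h1 h2.
  rewrite -[LHS]submxK h1 h2; congr block_mx.
  apply/matrixP => i j; have := WU (delta_mx j 0).
  rewrite -{1}[W]submxK mul_block_col !mulmx0 !addr0 => /eq_col_mx[_].
  by rewrite -colE => /matrixP/(_ i 0); rewrite !mxE.
exists U => //; apply: dot_isometry_unitarymx => x y.
have z0 : (0 : 'cV[C]_1) = const_mx 0 by apply/matrixP => i j; rewrite !mxE.
have := uW (col_mx x 0) (col_mx y 0); rewrite !WU z0 !herm_col_mx.
by rewrite !mul0r !subr0.
Qed.

(** The Cartan decomposition: once the phase makes its last coordinate positive,
    the image of [base] is reached by a boost, and what remains fixes [base]. *)
Lemma polar_decomposition (A : mat) : unitary_set A ->
  exists th q (U : 'M[C]_n), [/\ normc th = 1, U \is unitarymx,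
    boostc q = normc (lst (A *m base)) &
    th *: A = boost q *m block_mx U 0 0 1%:M].
Proof.
move=> uA; have A0 : lst (A *m base) != 0.
  rewrite -normc_eq0 gt_eqF // (lt_le_trans ltr01) //; exact: lst_base_ge1.
have [th th1 thE] := unit_phase A0.
have uB := unitary_set_scale th1 uA; set B := th *: A in uB.
have BE : normc (lst (B *m base)) = normc (lst (A *m base)).
  by rewrite /B -scalemxAl lstZ normcM th1 mul1r.
pose q := usubmx (B *m base).
have qE : boostc q = normc (lst (A *m base)) by rewrite -lst_base_boostc.
have uq := unitary_unitmx (boost_unitary q).
have qb : boost q *m base = B *m base.
  rewrite boost_base [RHS]vec_split; congr (col_mx _ (const_mx _)).
  by rewrite qE -thE /B -scalemxAl lstZ.
have [||U uU WE] := @stabilizer_block (invmx (boost q) *m B).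
- by apply: unitary_setM => //; exact/unitary_setV/boost_unitary.
- by rewrite -mulmxA -qb mulmxA mulVmx ?mul1mx.
by exists th, q, U; split => //; rewrite -WE mulmxA mulmxV ?mul1mx.
Qed.

Lemma enorm_stabilizer (U : 'M[C]_n) (v : vec) : U \is unitarymx ->
  enorm (block_mx U 0 0 1%:M *m v) = enorm v.
Proof.
move=> uU; apply/eqP; rewrite -(@eqrXn2 _ 2) ?enorm_ge0 //; apply/eqP.
rewrite (vec_split v) mul_block_col !mul0mx addr0 add0r mul1mx.
by rewrite !sqr_enorm_col_mx enorm_unitarymx.
Qed.

Lemma boost_opbound q : opbound (@boost R n q) (boostc q + enorm q).
Proof.
rewrite -[boost q](subrK 1) -[X in opbound _ X](subrK 1).
by apply: opboundD; [exact: boost_near1|exact: opbound1].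
Qed.

(** The unitary factor being isometric, only the boost counts. Here [c] and [s]
    are the hyperbolic cosine and sine of half the distance from [base] to its
    image. *)
Lemma unitary_opbound (A : mat) (c s : R) : unitary_set A ->
  c = normc (lst (A *m base)) -> s = Num.sqrt (c ^+ 2 - 1) ->
  opbound A (c + s).
Proof.
move=> uA cE sE; have [th [q [U [th1 uU qE AE]]]] := polar_decomposition uA.
move=> v; rewrite -[enorm v](enorm_stabilizer _ uU).
rewrite -[enorm (A *m v)]mul1r -th1 -enormZ scalemxAl AE -mulmxA.
have -> : c + s = boostc q + enorm q; last exact: boost_opbound.
rewrite sE cE -qE sqr_boostc [1 + _]addrC addrK sqrtr_sqr.
by rewrite ger0_norm ?enorm_ge0.
Qed.

Lemma unitary_opbound_base (A : mat) : unitary_set A ->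
  opbound A (2 * normc (lst (A *m base))).
Proof.
move=> uA; apply: opboundW (unitary_opbound uA erefl erefl).
have := lst_base_ge1 uA; set c := normc _ => c1.
rewrite mulr2n mulrDl mul1r lerD2l -[leRHS]ger0_norm ?(le_trans ler01) //.
by rewrite -sqrtr_sqr ler_wsqrtr // gerBl.
Qed.

Lemma lst_base_inv (A : mat) : unitary_set A ->
  normc (lst (invmx A *m base)) = normc (lst (A *m base)).
Proof.
move=> uA; rewrite -normcN -herm_base -[RHS]normcN -herm_base.
rewrite -[herm _ _ in LHS]uA mulmxA mulmxV ?unitary_unitmx // mul1mx.
exact: normc_hermC.
Qed.

(** Transitivity of U(n,1) on the ball, by a boost. The bounds keep track of what
    conjugation by [T] costs. *)
Lemma unitary_transitive (x : vec) : herm x x = -1 ->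
  exists T : mat, [/\ unitary_set T,
    exists2 th : C, normc th = 1 & T *m base = th *: x &
    opbound T (2 * enorm x) /\ opbound (invmx T) (2 * enorm x)].
Proof.
move=> xx; have xE : normc (lst x) ^+ 2 = 1 + enorm (usubmx x) ^+ 2.
  by move: xx; rewrite hermvv -[-1]/(- cx 1) -rmorphN => /complexI; lra.
have x0 : lst x != 0.
  rewrite -normc_eq0 -sqrf_eq0 xE gt_eqF // (lt_le_trans ltr01) // lerDl.
  exact: sqr_ge0.
have [th th1 thE] := unit_phase x0.
pose q := th *: usubmx x; have uT := boost_unitary q.
have qE : enorm q = enorm (usubmx x) by rewrite enormZ th1 mul1r.
have cE : boostc q = normc (lst x).
  by rewrite /boostc qE -xE sqrtr_sqr ger0_norm ?normc_ge0.
have Tb : boost q *m base = th *: x.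
  rewrite boost_base [RHS]vec_split linearZ /= lstZ; congr (col_mx _ (const_mx _)).
  by rewrite cE -thE.
have Tn : 2 * normc (lst (boost q *m base)) <= 2 * enorm x.
  rewrite ler_wpM2l // Tb lstZ normcM th1 mul1r; exact: normc_le_enorm.
exists (boost q); split => //; first by exists th.
split; apply: opboundW Tn _; first exact: unitary_opbound_base.
by rewrite -lst_base_inv //; apply: unitary_opbound_base; exact: unitary_setV.
Qed.

End PolarDecomposition.

(** * Powers close to the identity *)

Section NearIdentityPowers.
Variable R : realType.
Local Notation C := R[i].
Local Notation cx := (real_complex R).

Lemma normc_expB1 (l : C) k :
  normc l = 1 -> normc (l ^+ k - 1) <= k%:R * normc (l - 1).
Proof.
move=> l1; elim: k => [|k IH]; first by rewrite expr0 subrr normc_zero mul0r.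
have -> : l ^+ k.+1 - 1 = l * (l ^+ k - 1) + (l - 1) by rewrite exprS; ring.
apply: le_trans (normcD _ _) _.
by rewrite normcM l1 mul1r -natr1 mulrDl mul1r lerD2r.
Qed.

Lemma exprZmx m a (A : 'M[C]_m) k : (a *: A) ^+ k = a ^+ k *: A ^+ k.
Proof.
elim: k => [|k IH]; first by rewrite !expr0 scale1r.
by rewrite !exprS IH -!mulmxE -scalemxAl -scalemxAr scalerA.
Qed.

Lemma opboundX m (A : 'M[C]_m) w k : 0 <= w -> opbound A w -> opbound (A ^+ k) (w ^+ k).
Proof.
move=> w0 hA; elim: k => [|k IH]; first exact: opbound1.
by rewrite !exprS -mulmxE; apply: opboundM.
Qed.

(** One more factor turns the difference into
    [B * (B ^+ k - W ^+ k) + (B - W) * W ^+ k]. *)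
Lemma opbound_expB m (B W : 'M[C]_m) e k : 0 <= e ->
  opbound (B - W) e -> opbound B (1 + e) -> opbound W 1 ->
  opbound (B ^+ k - W ^+ k) ((1 + e) ^+ k - 1).
Proof.
move=> e0 hBW hB hW; elim: k => [|k IH].
  by rewrite !expr0 !subrr => v; rewrite mul0mx enorm0 mul0r.
have -> : B ^+ k.+1 - W ^+ k.+1 = B *m (B ^+ k - W ^+ k) + (B - W) *m W ^+ k.
  by rewrite !exprS -!mulmxE mulmxBl mulmxBr addrA subrK.
have -> : (1 + e) ^+ k.+1 - 1 = (1 + e) * ((1 + e) ^+ k - 1) + e * 1.
  by rewrite exprS; ring.
apply: opboundD; first by apply: opboundM => //; rewrite addr_ge0.
apply: opboundM => //; rewrite -(expr1n R k); exact: opboundX.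
Qed.

Lemma block1_exp n (U : 'M[C]_n) k :
  (block_mx U 0 0 1%:M : 'M[C]_(n + 1)) ^+ k = block_mx (U ^+ k) 0 0 1%:M.
Proof.
elim: k => [|k IH]; first by rewrite !expr0 -scalar_mx_block.
rewrite !exprS IH -!mulmxE mulmx_block.
by rewrite !mulmx0 !mul0mx !mulmx1 !addr0 !add0r.
Qed.

Lemma opbound_block1 n (U : 'M[C]_n) c : 0 <= c -> opbound (U - 1) c ->
  opbound ((block_mx U 0 0 1%:M : 'M[C]_(n + 1)) - 1) c.
Proof.
move=> c0 hU v; rewrite -ler_sqr ?nnegrE ?mulr_ge0 ?enorm_ge0 //.
rewrite (vec_split v) mulmxBl mul1mx mul_block_col !mul0mx addr0 add0r mul1mx.
rewrite opp_col_mx add_col_mx subrr exprMn !sqr_enorm_col_mx enorm0.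
rewrite expr0n /= addr0 mulrDr -[X in U *m X - X]mul1mx mulmxA mulmx1 -mulmxBl.
rewrite -[leLHS]addr0; apply: lerD; last by rewrite mulr_ge0 ?sqr_ge0.
by rewrite -exprMn ler_sqr ?nnegrE ?mulr_ge0 ?enorm_ge0.
Qed.

Lemma Bernoulli (e : R) k : 0 <= e -> k%:R * e <= (1 + e) ^+ k - 1.
Proof.
move=> e0; elim: k => [|k IH]; first by rewrite mul0r expr0 subrr.
rewrite exprS -natr1 mulrDl mul1r.
have : 1 <= (1 + e) ^+ k by rewrite exprn_ege1 // lerDl.
set p := (1 + e) ^+ k in IH *; move: IH; set q := k%:R * e => h1 h2.
have : 0 <= e * (p - 1) by rewrite mulr_ge0 // subr_ge0.
lra.
Qed.

Section Fixed.
Variable n : nat.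
Local Notation vec := 'cV[C]_(n + 1).
Local Notation mat := 'M[C]_(n + 1).
Local Notation base := (base R n).

Lemma null_vector (v : vec) : herm v v = 0 -> enorm (usubmx v) = normc (lst v).
Proof.
rewrite hermvv -[0]/(cx 0) => /complexI/eqP; rewrite subr_eq0.
by rewrite eqrXn2 ?enorm_ge0 ?normc_ge0 // => /eqP.
Qed.

Lemma null_lst_neq0 (v : vec) : herm v v = 0 -> v != 0 -> lst v != 0.
Proof.
move=> /null_vector vv; apply: contra => /eqP l0.
by rewrite -enorm_eq0 -sqrf_eq0 sqr_enorm_split vv l0 normc_zero expr0n addr0.
Qed.

(** The boost moves a null eigenvector [v] by little, and comparing last
    coordinates shows that [mu] is close to 1; so [U] almost fixes the first
    component of [v], that is, has a small rotation angle. *)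
Lemma polar_almost_fixed (q : 'cV[C]_n) (U : 'M[C]_n) (v : vec) mu :
  U \is unitarymx -> herm v v = 0 ->
  boost q *m block_mx U 0 0 1%:M *m v = mu *: v ->
  enorm (U *m usubmx v - usubmx v)
    <= 3 * (boostc q + enorm q - 1) * enorm (usubmx v).
Proof.
move=> uU vv0 Bv; set e := boostc q + enorm q - 1.
have [->|v0] := eqVneq v 0; first by rewrite linear0 mulmx0 subr0 enorm0 mulr0.
have vE := null_vector vv0; have l0 := null_lst_neq0 vv0 v0.
set r := enorm (usubmx v) in vE *.
have r0 : 0 < r by rewrite vE lt_def normc_eq0 l0 normc_ge0.
set W := block_mx U 0 0 1%:M in Bv.
have WE : W *m v = col_mx (U *m usubmx v) (const_mx (lst v)).
  by rewrite {1}(vec_split v) mul_block_col !mul0mx addr0 add0r mul1mx.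
have c1 := boostc_ge1 q; have s0 := enorm_ge0 q.
have e0 : 0 <= e by rewrite /e; lra.
have mu1 : normc (mu - 1) <= e.
  move: Bv; rewrite -mulmxA WE boostE => /(congr1 (@lst R n)).
  rewrite lst_col_mx lstZ => E.
  have {}E : (mu - cx (boostc q)) * lst v = dot (U *m usubmx v) q.
    by rewrite mulrBl -E addrK.
  have h : normc (mu - cx (boostc q)) <= enorm q.
    rewrite -(ler_pM2r r0) {1}vE -normcM E.
    apply: le_trans (CauchySchwarz_dot _ _) _.
    by rewrite enorm_unitarymx // mulrC.
  have -> : mu - 1 = (mu - cx (boostc q)) + cx (boostc q - 1).
    by rewrite rmorphB /= -[cx 1]/(1 : C); ring.
  apply: le_trans (normcD _ _) _; rewrite normcR ger0_norm /e; lra.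
have -> : enorm (U *m usubmx v - usubmx v) = enorm (W *m v - v).
  apply/eqP; rewrite -(@eqrXn2 _ 2) ?enorm_ge0 //; apply/eqP.
  rewrite WE [in RHS](vec_split v) col_mxKu lst_col_mx opp_col_mx add_col_mx.
  by rewrite subrr sqr_enorm_col_mx enorm0 expr0n addr0.
have -> : W *m v - v = (mu - 1) *: v - (boost q - 1) *m (W *m v).
  by rewrite mulmxBl mul1mx mulmxA Bv scalerBl scale1r opprB [RHS]addrC addrA subrK.
(* [enorm v] is the square root of 2 times [r], as [v] is null. *)
have vr : enorm v <= 3 / 2 * r.
  rewrite -ler_sqr ?nnegrE ?mulr_ge0 ?enorm_ge0 ?(ltW r0) //.
  rewrite sqr_enorm_split -vE -/r.
  have : 0 <= r ^+ 2 by exact: sqr_ge0.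
  by rewrite exprMn; lra.
apply: le_trans (enormB _ _) _; rewrite enormZ.
have h1 : normc (mu - 1) * enorm v <= e * enorm v by rewrite ler_wpM2r ?enorm_ge0.
have h2 : enorm ((boost q - 1) *m (W *m v)) <= e * enorm v.
  by rewrite -[enorm v](enorm_stabilizer _ uU); exact: boost_near1.
have h3 : e * enorm v <= e * (3 / 2 * r) by rewrite ler_wpM2l.
lra.
Qed.

End Fixed.

(** Of the [n] angles of the unitary part of [A] one is already small, so Dirichlet's
    theorem is needed for [n - 1] of them only. The bound [63 / 170] is the arc
    length [63 / 10 / 17], and [1 / 99 = 100 / 99 - 1] is what the boosts
    accumulate. *)
Lemma near_identity_power n (A : 'M[C]_(n + 1)) (c w : R) v mu :
  (0 < n)%N -> unitary_set A ->
  c = normc (lst (A *m base R n)) -> c + Num.sqrt (c ^+ 2 - 1) <= w ->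
  w ^+ (17 ^ (n - 1)) <= 100 / 99 ->
  v != 0 -> herm v v = 0 -> A *m v = mu *: v ->
  exists k th, [/\ (0 < k)%N, normc th = 1,
    opbound (th *: A ^+ k - 1) (63 / 170 + 1 / 99)
  & opbound (invmx A ^+ k) (100 / 99)].
Proof.
case: n A v => // n A v _ uA cE cw wE v0 vv0 Av.
have [th [q [U [th1 uU qE AE]]]] := polar_decomposition uA.
rewrite -cE in qE; have c1 : 1 <= c by rewrite -qE boostc_ge1.
have sE : Num.sqrt (c ^+ 2 - 1) = enorm q.
  by rewrite -qE sqr_boostc [1 + _]addrC addrK sqrtr_sqr ger0_norm ?enorm_ge0.
set e := boostc q + enorm q - 1.
have e0 : 0 <= e by rewrite /e; have := boostc_ge1 q; have := enorm_ge0 q; lra.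
have ew : 1 + e <= w by rewrite /e addrC subrK qE -sE.
have [l [l1 lk lfix]] := unitary_spectrum uU.
have vu0 : usubmx v != 0.
  by rewrite -enorm_eq0 null_vector // normc_eq0 null_lst_neq0.
have [i0 li0] : exists i, normc (l i - 1) <= 3 * e.
  apply: lfix vu0 _; apply: (@polar_almost_fixed _ _ _ _ (th * mu)) => //.
  by rewrite -AE -scalemxAl Av scalerA.
have [k [/andP[k0 kN] kl]] := @simultaneous_approximation R n 16 (l \o lift i0)
  (fun i => l1 _).
have {}wE : w ^+ k <= 100 / 99.
  apply: le_trans wE; rewrite ler_weXn2l //; first by lra.
  by rewrite subn1.
have ekE : (1 + e) ^+ k <= 100 / 99.
  by apply: le_trans wE; rewrite lerXn2r ?nnegrE //; lra.
have lkE i : normc (l i ^+ k - 1) <= 63 / 170.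
  have [j ->|->] := unliftP i0 i.
    by apply: le_trans (kl j) _; lra.
  apply: le_trans (normc_expB1 _ (l1 _)) _.
  have := Bernoulli k e0; move: li0.
  have : 0 <= k%:R :> R by []. 
  set x := normc _; set kk := k%:R => kk0 h1 h2.
  have : kk * x <= kk * (3 * e) by rewrite ler_wpM2l.
  lra.
have Vw : opbound (invmx A) w.
  apply: (opboundW cw); apply: unitary_opbound (unitary_setV uA) _ erefl.
  by rewrite lst_base_inv.
have w0 : 0 <= w by lra.
exists k, (th ^+ k); split => //.
- by rewrite normcX th1 expr1n.
- set W := block_mx U 0 0 1%:M in AE.
  have -> : th ^+ k *: A ^+ k - 1 = ((th *: A) ^+ k - W ^+ k) + (W ^+ k - 1).
    by rewrite addrA subrK exprZn.
  rewrite addrC; apply: opboundD.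
    rewrite block1_exp; apply: opbound_block1; first by lra.
    exact: lk.
  apply: (@opboundW _ _ _ ((1 + e) ^+ k - 1)); first by lra.
  have W1 : opbound W 1 by move=> x; rewrite enorm_stabilizer // mul1r.
  apply: opbound_expB => //.
    rewrite AE -[X in _ - X]mul1mx -mulmxBl -[e]mulr1.
    by apply: opboundM => //; exact: boost_near1.
  rewrite AE -[1 + e]mulr1; apply: opboundM => //; first by lra.
  by rewrite /e addrC subrK; exact: boost_opbound.
- by apply: opboundW wE _; exact: opboundX.
Qed.

End NearIdentityPowers.

(** * Eigenvectors and boundary fixed points *)

Section Eigenvectors.
Variables (R : realType) (n : nat).
Local Notation C := R[i].
Local Notation vec := 'cV[C]_(n + 1).
Local Notation mat := 'M[C]_(n + 1).
Local Notation cx := (real_complex R).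

Lemma herm_mx (v : vec) (u : 'rV[C]_(n + 1)) :
  u *m (@hermJ R n *m map_mx Num.conj v) = const_mx (herm u^T v).
Proof.
by apply/matrixP => i j; rewrite !ord1 [RHS]mxE hermE trmxK mulmxA.
Qed.

(** As long as an invariant subspace [V] contains a negative vector, so does the
    orthogonal in [V] of a positive eigenvector; the dimension decreases until
    an eigenvector is not positive. *)
Lemma nonpositive_eigenvector (A : mat) : unitary_set A ->
  exists v mu, [/\ v != 0, A *m v = mu *: v & herm v v <= 0].
Proof.
move=> uA.
suff H r (V : mat) : (\rank V <= r)%N -> (V *m A^T <= V)%MS ->
    (exists2 x : vec, (x^T <= V)%MS & herm x x < 0) ->
    exists v mu, [/\ v != 0, A *m v = mu *: v & herm v v <= 0].
  apply: (H (n + 1)%N 1%:M); rewrite ?rank_leq_row ?submx1 //.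
  by exists (base R n); rewrite ?submx1 // herm_basebase ltrN10.
elim: r V => [|r IH] V rV sV [x xV x0].
  move: rV x0; rewrite leqn0 mxrank_eq0 => /eqP V0.
  move: xV; rewrite V0 submx0 => /eqP/(congr1 trmx); rewrite trmxK trmx0 => ->.
  by rewrite herm0l ltxx.
have V0 : (0 < \rank V)%N.
  rewrite lt0n mxrank_eq0; apply: contraTneq x0 => V0.
  move: xV; rewrite V0 submx0 => /eqP/(congr1 trmx); rewrite trmxK trmx0 => ->.
  by rewrite herm0l ltxx.
have [//|v' v'0 /= /andP[sv' _]] :=
    @common_eigenvector _ _ [:: restrictmx V A^T] V0.
  by move=> B B'; rewrite !inE => /eqP-> /eqP->.
set u := v' *m row_base V.
have u0 : u != 0 by rewrite mulmx_free_eq0 ?row_base_free.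
have uV : (u <= V)%MS by rewrite (submx_trans (submxMl _ _)) ?eq_row_base.
have : (u *m A^T <= u)%MS by rewrite -stablemx_restrict.
move=> /sub_rVP[mu uE]; pose v : vec := u^T.
have v0 : v != 0 by rewrite -(trmx0) (inj_eq trmx_inj).
have Av : A *m v = mu *: v.
  by apply: trmx_inj; rewrite trmx_mul trmxK uE linearZ /= trmxK.
have [vneg|vpos] := boolP (herm v v <= 0); first by exists v, mu.
have vv : 0 < herm v v.
  move: vpos; rewrite hermvv -[0]/(cx 0) lecR ltcR -ltNge //.
have mu0 : mu^* != 0.
  rewrite conjC_eq0; apply: contraTneq vv => m0.
  by rewrite -(uA v v) Av m0 scale0r herm0l ltxx.
pose K := kermx (@hermJ R n *m map_mx Num.conj v).
have inK (y : vec) : (y^T <= K)%MS <-> herm y v = 0.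
  rewrite /K; split => [/sub_kermxP|h]; last first.
    by apply/sub_kermxP; rewrite herm_mx trmxK h; apply/matrixP => i j; rewrite !mxE.
  by rewrite herm_mx trmxK => /matrixP/(_ 0 0); rewrite !mxE.
have AK (y : vec) : herm y v = 0 -> herm (A *m y) v = 0.
  move=> yv; apply: (mulfI mu0); rewrite mulr0 -hermZr -Av uA //.
apply: (IH (V :&: K)%MS).
- rewrite -ltnS (leq_trans _ rV) // ltnNge; apply/negP => le.
  have VK : (V <= V :&: K)%MS.
    by rewrite -mxrank_leqif_sup ?capmxSl // eqn_leq le mxrankS ?capmxSl.
  have : (v^T <= K)%MS.
    by rewrite trmxK (submx_trans uV) // (submx_trans VK) ?capmxSr.
  by move=> /inK vv0; rewrite vv0 ltxx in vv.
- rewrite sub_capmx (submx_trans (submxMr _ (capmxSl _ _)) sV) /=.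
  apply/row_subP => i; rewrite row_mul.
  set y := row i _; have yK : (y <= K)%MS.
    by rewrite (submx_trans (row_sub _ _)) ?capmxSr.
  have -> : y *m A^T = (A *m y^T)^T by rewrite trmx_mul trmxK.
  by apply/inK/AK/inK; rewrite trmxK.
- pose t := herm x v / herm v v; exists (x - t *: v).
    rewrite sub_capmx; apply/andP; split.
      rewrite linearB linearZ /= trmxK addmx_sub ?eqmx_opp //.
      by rewrite scalemx_sub.
    apply/inK; rewrite -scaleNr hermDl hermZl mulNr divfK ?subrr //.
    by rewrite gt_eqF.
  have vvr : (herm v v)^* = herm v v by rewrite herm_conj.
  have vvn : herm v v != 0 by rewrite gt_eqF.
  have -> : herm (x - t *: v) (x - t *: v) =
      herm x x - (herm x v) * (herm x v)^* / herm v v.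
    rewrite -scaleNr hermDl !hermDr !hermZl !hermZr -(herm_conj x v).
    by rewrite /t rmorphN fmorph_div /= vvr; field.
  by rewrite (le_lt_trans _ x0) // gerBl divr_ge0 ?mul_conjC_ge0 ?ltW.
Qed.

Definition has_negative_eigenvector (A : mat) :=
  exists v mu, A *m v = mu *: v /\ herm v v < 0.

(** Boundary points are represented by their affine coordinates, like the points
    of the ball. *)
Definition sphere (z : 'cV[C]_n) := enorm z = 1.

Definition fixes (A : mat) (z : 'cV[C]_n) :=
  exists mu, A *m lift_pt z = mu *: lift_pt z.

Lemma lst_lift (z : 'cV[C]_n) : lst (lift_pt z) = 1.
Proof. exact: lst_col_mx. Qed.

Lemma herm_lift_dot (z w : 'cV[C]_n) : herm (lift_pt z) (lift_pt w) = dot z w - 1.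
Proof. by rewrite herm_col_mx conjC1 mulr1. Qed.

Lemma sphereP (z : 'cV[C]_n) : sphere z <-> herm (lift_pt z) (lift_pt z) = 0.
Proof.
rewrite herm_lift_dot dotvv; split => [->|]; first by rewrite expr1n subrr.
rewrite -[1]/(cx 1) -rmorphB -[0]/(cx 0) => /complexI/eqP.
rewrite subr_eq0 -[1](expr1n _ 2) eqrXn2 ?enorm_ge0 // => /eqP //.
Qed.

Lemma lift_neq0 (z : 'cV[C]_n) : lift_pt z != 0.
Proof.
apply/negP => /eqP/(congr1 (@lst R n)); rewrite lst_lift /lst mxE => /eqP.
by rewrite oner_eq0.
Qed.

(** The case of equality in Cauchy-Schwarz: unit vectors with product 1 are equal. *)
Lemma sphere_herm_neq0 (z w : 'cV[C]_n) :
  sphere z -> sphere w -> z <> w -> herm (lift_pt z) (lift_pt w) != 0.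
Proof.
move=> sz sw zw; apply/negP => /eqP; rewrite herm_lift_dot => /eqP.
rewrite subr_eq0 => /eqP d1; apply: zw; apply/eqP.
rewrite -subr_eq0 -enorm_eq0 -sqrf_eq0 -(inj_eq (@complexI R)) -dotvv.
rewrite -scaleN1r dotDl !dotDr !dotZl !dotZr !dotvv sz sw -(dotC z w) d1.
by rewrite !rmorphN !rmorph1 !expr1n rmorph1; apply/eqP; ring.
Qed.

Lemma eigen_pair (A : mat) (v w : vec) mu nu : unitary_set A ->
  A *m v = mu *: v -> A *m w = nu *: w -> herm v w != 0 -> mu * nu^* = 1.
Proof.
move=> uA Av Aw vw; apply: (mulIf vw).
by rewrite mul1r -hermZ -Av -Aw uA.
Qed.

(** By [eigen_pair] the eigenvalues of two fixed points are inverse to each other's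
    conjugate. With three fixed points they are all equal, so that sums of the
    null vectors are eigenvectors, and one of these sums is negative. *)
Lemma fixes_three (A : mat) (x y z : 'cV[C]_n) : unitary_set A ->
  sphere x -> sphere y -> sphere z -> x <> y -> y <> z -> x <> z ->
  fixes A x -> fixes A y -> fixes A z -> has_negative_eigenvector A.
Proof.
move=> uA sx sy sz xy yz xz [a Aa] [b Ab] [c Ac].
have vw := sphere_herm_neq0 sx sy xy.
have bc := eigen_pair uA Ab Ac (sphere_herm_neq0 sy sz yz).
have ac := eigen_pair uA Aa Ac (sphere_herm_neq0 sx sz xz).
have c0 : c^* != 0.
  apply/negP => /eqP E; move: ac; rewrite E mulr0 => /eqP.
  by rewrite eq_sym oner_eq0.
have ab : a = b by apply: (mulIf c0); rewrite ac bc.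
set v := lift_pt x in Aa vw; set w := lift_pt y in Ab vw.
exists (v + (- herm v w) *: w), a; split.
  by rewrite mulmxDr -scalemxAr Aa Ab ab scalerDr !scalerA mulrC.
rewrite hermDl !hermDr !hermZl !hermZr.
have /sphereP -> := sx; have /sphereP -> := sy.
rewrite -(herm_conj v w) !mulr0 addr0 add0r !rmorphN !mulNr.
rewrite [(_)^* * _]mulrC -opprD oppr_lt0 addr_gt0 //;
  by rewrite mulc_conj -[0]/(cx 0) ltcR exprn_gt0 // lt_def normc_eq0 vw normc_ge0.
Qed.

Lemma exists_fixed (A : mat) : unitary_set A -> ~ has_negative_eigenvector A ->
  exists2 z, sphere z & fixes A z.
Proof.
move=> uA nA; have [v [mu [v0 Av vv]]] := nonpositive_eigenvector uA.
have {}vv : herm v v = 0.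
  move: vv; rewrite le_eqVlt => /orP[/eqP //|vneg].
  by case: nA; exists v, mu.
have l0 := null_lst_neq0 vv v0.
exists (proj_pt v); rewrite ?/fixes; last exists mu; rewrite ?sphereP lift_proj //.
  by rewrite hermZ vv mulr0.
by rewrite -scalemxAr Av !scalerA mulrC.
Qed.

End Eigenvectors.

(** * Torsion-free actions with at most two fixed points *)

Section TorsionFreeActions.
Local Open Scope group_scope.
Variables (gT : groupType) (X : Type) (S : set X) (to : gT -> X -> X).
Variable G : set gT.
Hypothesis to1 : forall x, S x -> to 1 x = x.
Hypothesis toM : forall f g x, S x -> to (f * g) x = to f (to g x).
Hypothesis toS : forall f x, S x -> S (to f x).
Hypothesis GM : forall f g, G f -> G g -> G (f * g).
Hypothesis GV : forall f, G f -> G f^-1.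
Hypothesis G_torsion_free :
  forall f, G f -> f <> 1 -> forall k, (0 < k)%N -> f ^+ k <> 1.

Definition Fix (f : gT) : set X := [set x | S x /\ to f x = x].

Hypothesis Fix_nonempty : forall f, G f -> f <> 1 -> exists x, Fix f x.
Hypothesis Fix_le2 : forall f, G f -> f <> 1 ->
  forall x y z, Fix f x -> Fix f y -> Fix f z -> [\/ x = y, y = z | x = z].

Lemma to_inj f x y : S x -> S y -> to f x = to f y -> x = y.
Proof.
by move=> Sx Sy E; rewrite -(to1 Sx) -(to1 Sy) -(mulVg f) !toM // E.
Qed.

Lemma group_exp f k : G f -> (0 < k)%N -> G (f ^+ k).
Proof.
case: k => // k Gf _; elim: k => [|k IH]; first by rewrite expg1.
by rewrite expgS; apply: GM.
Qed.

Lemma Fix_sub_exp f k : Fix f `<=` Fix (f ^+ k).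
Proof.
move=> x [Sx fx]; split => //; elim: k => [|k IH]; first by rewrite expg0 to1.
by rewrite expgS toM // IH.
Qed.

(** [f] permutes the at most two fixed points of [f ^+ k], and it fixes at
    least one of them. *)
Lemma Fix_exp f k : G f -> f <> 1 -> (0 < k)%N -> Fix (f ^+ k) = Fix f.
Proof.
move=> Gf f1 k0; apply/seteqP; split; last exact: Fix_sub_exp.
move=> x [Sx fkx]; split => //.
have [p [Sp fp]] := Fix_nonempty Gf f1.
have fkfx : to (f ^+ k) (to f x) = to f x.
  by rewrite -toM // -expgSr expgS toM // fkx.
have [E|E|E] : [\/ p = x, x = to f x | p = to f x].
- apply: (Fix_le2 (group_exp Gf k0) (G_torsion_free Gf f1 k0)) => //.
  + exact: Fix_sub_exp.
  + by split; first exact: toS.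
- by rewrite -E.
- by [].
- by rewrite -E; apply: (@to_inj f); rewrite ?fp.
Qed.

Definition preserves (c : gT) (A : set X) := forall x, A x -> A (to c x).

(** Among [x], [g x] and [g (g x)] two are equal, so [g ^+ 2] fixes [x]; and squares
    have no new fixed points. *)
Lemma preserves_Fix f g : G f -> f <> 1 -> G g -> g <> 1 ->
  preserves g (Fix f) -> Fix f `<=` Fix g.
Proof.
move=> Gf f1 Gg g1 gF x Fx; have Sx := Fx.1.
have Fgx := gF _ Fx; have Fggx := gF _ Fgx.
rewrite -(Fix_exp Gg g1 (ltn0Sn 1)); split => //.
rewrite expgS expg1 toM //.
have [E|E|E] := Fix_le2 Gf f1 Fx Fgx Fggx; first by rewrite -!E.
  rewrite -E; apply: (@to_inj g); [exact: toS|by []|exact: esym].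
by rewrite -E.
Qed.

(** The fixed points of [a ^ c] are the preimages under [c] of those of [a]. *)
Lemma preserves_conj a c : G a -> a <> 1 -> G c ->
  preserves (a ^ c) (Fix a) -> preserves c (Fix a).
Proof.
move=> Ga a1 Gc h x Fx.
have Gac : G (a ^ c) by apply: GM; [exact: GV|exact: GM].
have ac1 : a ^ c <> 1.
  by move=> /(canRL (conjgK _)); rewrite conj1g.
have [Sx] := preserves_Fix Ga a1 Gac ac1 h Fx.
have Scx := toS c Sx; have Sacx := toS a Scx.
rewrite /conjg !toM // => E; split => //.
by apply: (@to_inj c^-1) => //; rewrite E -toM // mulVg to1.
Qed.

(** The identity preserves the fixed points of [a]. If [[a, b]] does, then so does
    [a ^ b = a [a, b]], and [preserves_conj] passes this on to [b]. *)
Lemma iter_commg_Fix a b j : G a -> a <> 1 -> G b -> b <> 1 ->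
  iter j (fun c => [~ a, c]) b = 1 -> Fix a `<=` Fix b.
Proof.
move=> Ga a1 Gb b1 bj; apply: preserves_Fix => //.
elim: j b Gb {b1} bj => [|j IH] b Gb; first by move=> /= -> x [Sx fx]; rewrite to1.
rewrite iterSr => /IH bF x Fx; apply: preserves_conj Fx => // {}x Fx.
have Gc : G [~ a, b].
  by rewrite commgEl /conjg; apply: GM; [exact: GV|apply: GM; [exact: GV|exact: GM]].
have Fc := bF Gc _ Fx.
have -> : a ^ b = a * [~ a, b] by rewrite commgEl mulgA mulgV mul1g.
by rewrite toM ?Fc.2 //; case: Fx.
Qed.

End TorsionFreeActions.

(** * Commutators of matrices close to the identity *)

Section CommutatorContraction.
Variables (R : realType) (n : nat).
Local Notation U := (Un1 R n).
Local Notation near1 a x := (opbound (Un1_mx a - 1) x).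

(** The difference [[a, b] - 1] is [a^-1 b^-1 (a b - b a)], and [a b - b a] is also
    the commutator of [a - 1] and [b - 1]. The inverse of [[a, b]] is estimated
    as well because it enters the next commutator. *)
Lemma commg_near1 (a b : U) (al x e e' : R) :
  0 <= al -> 0 <= x -> 0 <= e -> 0 <= e' ->
  near1 a al -> near1 b x ->
  opbound (Un1_mx a^-1%g) e -> opbound (Un1_mx b^-1%g) e' ->
  near1 [~ a, b]%g (e * e' * (2 * al * x)) /\
  near1 ([~ a, b]^-1)%g (e * e' * (2 * al * x)).
Proof.
move=> al0 x0 e0 e'0 ha hb hia hib.
pose Y := Un1_mx a *m Un1_mx b - Un1_mx b *m Un1_mx a.
have hY : opbound Y (2 * al * x).
  have -> : Y = (Un1_mx a - 1) *m (Un1_mx b - 1) - (Un1_mx b - 1) *m (Un1_mx a - 1).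
    rewrite !mulmxBl !mulmxBr !mulmx1 !mul1mx /Y.
    move: (Un1_mx a *m Un1_mx b) (Un1_mx b *m Un1_mx a) => M N.
    by apply/matrixP => i j; rewrite !mxE; ring.
  rewrite mulr_natl mulr2n mulrDl; apply: opboundB; last rewrite mulrC;
    by apply: opboundM.
have YV : Un1_mx [~ a, b]%g - 1 = Un1_mx a^-1%g *m (Un1_mx b^-1%g *m Y).
  rewrite /Y !mulmxBr -!Un1_mxM; congr (_ - _).
  by rewrite [(b^-1 * _)%g]mulgA mulVg mul1g mulVg.
have YV' : Un1_mx [~ a, b]^-1%g - 1 = Un1_mx b^-1%g *m (Un1_mx a^-1%g *m (- Y)).
  rewrite /Y opprB !mulmxBr -!Un1_mxM; congr (_ - _).
    by rewrite commgEl /conjg !invgM !invgK !mulgA.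
  by rewrite [(a^-1 * _)%g]mulgA mulVg mul1g mulVg.
split; first by rewrite YV -mulrA; exact: (opboundM e0 hia (opboundM e'0 hib hY)).
rewrite YV' -mulrA mulrCA.
exact: (opboundM e'0 hib (opboundM e0 hia (opboundN hY))).
Qed.

(** The first commutator and its inverse are at distance [x] from the identity at
    most. From then on all inverses are bounded by [1 + x], and each commutator
    multiplies the distance by at most the ratio supposed to be less than 1. *)
Lemma iter_commg_cvg1 (a b : U) (al e : R) :
  let x := e * e * (2 * al * al) in
  0 <= al -> 0 <= e -> e * (1 + x) * (2 * al) < 1 ->
  near1 a al -> near1 b al ->
  opbound (Un1_mx a^-1%g) e -> opbound (Un1_mx b^-1%g) e ->
  forall r, 0 < r -> exists j, near1 (iter j (fun c => [~ a, c]%g) b) r.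
Proof.
move=> x al0 e0 q1 ha hb hia hib r r0.
have x0 : 0 <= x by rewrite !mulr_ge0.
set q := e * (1 + x) * (2 * al) in q1.
have q0 : 0 <= q by rewrite !mulr_ge0 // addr_ge0.
pose c j := iter j.+1 (fun c => [~ a, c]%g) b.
have H j : near1 (c j) (x * q ^+ j) /\ near1 (c j)^-1%g (x * q ^+ j).
  elim: j => [|j [IH IHV]]; first by rewrite expr0 mulr1; exact: commg_near1.
  have xq : x * q ^+ j <= x by rewrite ler_piMr // exprn_ile1 // ltW.
  have hic : opbound (Un1_mx (c j)^-1%g) (1 + x).
    rewrite -[Un1_mx _](subrK 1) [1 + x]addrC; apply: opboundD; last exact: opbound1.
    exact: opboundW xq IHV.
  have -> : x * q ^+ j.+1 = e * (1 + x) * (2 * al * (x * q ^+ j)).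
    by rewrite exprS /q; ring.
  have xq0 : 0 <= x * q ^+ j by rewrite mulr_ge0 ?exprn_ge0.
  have x10 : 0 <= 1 + x by rewrite addr_ge0.
  exact: (commg_near1 al0 xq0 e0 x10 ha IH hia hic).
have [j hj] : exists j, x * q ^+ j <= r.
  have : x * q ^+ j @[j --> \oo] --> (x * 0 : R).
    apply: cvgM; first exact: cvg_cst.
    by apply: cvg_expr; rewrite ger0_norm.
  rewrite mulr0 => /cvgr0_norm_lt/(_ r r0)[N _ /(_ N (leqnn N))] /= h.
  by exists N; rewrite ltW // (le_lt_trans (ler_norm _)).
by exists j.+1; exact: opboundW hj (H j).1.
Qed.

End CommutatorContraction.

(** * Discrete groups of matrices *)

Section Discreteness.
Variables (R : realType) (n : nat).
Local Notation C := R[i].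
Local Notation U := (Un1 R n).
Local Notation mat := 'M[C]_(n + 1).
Local Notation cx := (real_complex R).

Lemma nbhs_matrix_opbound (V : set mat) (M : mat) : nbhs M V ->
  exists2 r : R, 0 < r & forall N, opbound (N - M) r -> V N.
Proof.
move=> /nbhs_ballP[e e0 eV].
have eE : e = cx (complex.Re e) by rewrite RRe_real // gtr0_real.
have re0 : 0 < complex.Re e by rewrite -ltcR -eE.
exists (complex.Re e / 2); first by rewrite divr_gt0.
move=> N hN; apply: eV; split => // i j.
rewrite -ball_normE /ball_ /= eE normc_normr ltcR.
rewrite normc_distC; have := opbound_entry i j hN; rewrite !mxE.
by move=> /le_lt_trans; apply; rewrite ltr_pdivrMr // ltr_pMr // ltr1n.
Qed.

(** The projection of U(n,1) onto PU(n,1) is continuous, and operator norm balls are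
    neighbourhoods in the entrywise topology. *)
Lemma discrete_radius (G : set (PUn1 R n)) : discrete G ->
  exists2 r : R, 0 < r & forall A : U, G (PUn1_pi A) ->
    opbound (Un1_mx A - 1) r -> PUn1_pi A = 1%g.
Proof.
move=> [_ [V V1 VG]].
have : nbhs (1%g : U) (@PUn1_pi R n @^-1` V) by exact: (@PUn1_pi_continuous R n 1%g).
rewrite nbhsE => -[B [Bo B1] BV].
move: Bo => -[W Wo WB].
have /nbhs_matrix_opbound[r r0 rW] : nbhs (1%:M : mat) W.
  by apply: open_nbhs_nbhs; split => //; move: B1; rewrite -WB.
exists r => // A GA hA.
have : (V `&` G) (PUn1_pi A).
  by split => //; apply: BV; rewrite -WB; exact: rW.
by rewrite VG.
Qed.

(** Two elements with the same integer parts of their rescaled entries have a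
    quotient close to the identity, hence are equal. *)
Lemma bounded_finite (G : set (PUn1 R n)) (K : R) : subgroup G -> discrete G ->
  finite_set [set f | exists A : U, [/\ f = PUn1_pi A, G f,
    opbound (Un1_mx A) K & opbound (Un1_mx A^-1%g) K]].
Proof.
move=> [G1 GD] dG; have [r r0 hr] := discrete_radius dG.
pose m : R := (n + 1)%:R; have m0 : 0 < m by rewrite ltr0n addn1.
pose N := (Num.truncn (K * (m * (m * 2)) / r)).+1.
have N0 : 0 < N%:R :> R by rewrite ltr0n.
have NK : K * (m * (m * (2 / N%:R))) <= r.
  have := truncnS_gt (K * (m * (m * 2)) / r); rewrite -/N ltr_pdivrMr // => h.
  rewrite -(ler_pM2r N0) [leRHS]mulrC (le_trans _ (ltW h)) //.
  by rewrite le_eqVlt; apply/orP; left; apply/eqP; field; rewrite gt_eqF.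
pose M := Num.truncn ((K + K) * N%:R).
pose cR (x : R) : 'I_M.+1 := inord (Num.truncn ((x + K) * N%:R)).
have cRP (x y : R) : `|x| <= K -> `|y| <= K -> cR x = cR y -> `|x - y| <= N%:R^-1.
  rewrite !ler_norml => /andP[x1 x2] /andP[y1 y2] /(congr1 val) /=.
  have xp : 0 <= (x + K) * N%:R by rewrite mulr_ge0 ?(ltW N0) // -lerBlDr sub0r.
  have yp : 0 <= (y + K) * N%:R by rewrite mulr_ge0 ?(ltW N0) // -lerBlDr sub0r.
  have lt z : z <= K -> (Num.truncn ((z + K) * N%:R) < M.+1)%N.
    by move=> zK; rewrite ltnS le_truncn // ler_pM2r // lerD2r.
  rewrite !inordK ?lt // => E.
  have /andP[a0 a1] := truncn_itv xp; have /andP[b0 b1] := truncn_itv yp.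
  rewrite E -natr1 in a0 a1; rewrite -natr1 in b1.
  have d1 : `|(x - y) * N%:R| <= 1.
    have -> : (x - y) * N%:R = (x + K) * N%:R - (y + K) * N%:R by ring.
    move: ((x + K) * N%:R) ((y + K) * N%:R) (_%:R) a0 a1 b0 b1 => p q u.
    by clear; rewrite ler_norml => *; apply/andP; split; lra.
  by rewrite -ler_norml -[leRHS]mul1r ler_pdivlMr // -{1}(ger0_norm (ltW N0)) -normrM.
pose cell (A : U) := [ffun p : 'I_(n + 1) * 'I_(n + 1) =>
  (cR (complex.Re (Un1_mx A p.1 p.2)), cR (complex.Im (Un1_mx A p.1 p.2)))].
pose S A f := [/\ f = PUn1_pi A, G f, opbound (Un1_mx A) K & opbound (Un1_mx A^-1%g) K].
pose rep c := xget 1%g [set f | exists A, S A f /\ cell A = c].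
apply: (@sub_finite_set _ _ (rep @` setT)); last exact/finite_image/finite_finset.
move=> f [A SA]; exists (cell A) => //.
rewrite /rep; case: xgetP => [g _ /= [B [SB BA]]|/(_ f)]; last by case; exists A.
case: SA => fE Gf hA hA'; case: SB => gE Gg hB hB'.
have Gfg : G (PUn1_pi (B^-1 * A)%g).
  rewrite PUn1_piM PUn1_piV -fE -gE; apply: set_mem.
  have := group_closedM (conj G1 GD); apply; last exact: mem_set.
  by apply: (group_closedV (conj G1 GD)); exact: mem_set.
have entry i j : normc ((Un1_mx A - Un1_mx B) i j) <= 2 / N%:R.
  have /ffunP/(_ (i, j)) := BA; rewrite !ffunE /= => -[hRe hIm].
  have bnd (z : C) : normc z <= K -> `|complex.Re z| <= K /\ `|complex.Im z| <= K.
    by move=> zK; split; apply: le_trans zK; [exact: Re_abs_le|exact: Im_abs_le].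
  have [a1 a2] := bnd _ (opbound_entry i j hA).
  have [b1 b2] := bnd _ (opbound_entry i j hB).
  have h1 := cRP _ _ a1 b1 (esym hRe); have h2 := cRP _ _ a2 b2 (esym hIm).
  rewrite !mxE; apply: le_trans (normc_le_ReIm _) _.
  rewrite mulr_natl mulr2n lerD //.
    by case: (Un1_mx A i j) (Un1_mx B i j) h1 => [a b] [c d].
  by case: (Un1_mx A i j) (Un1_mx B i j) h2 => [a b] [c d].
have AB : opbound (Un1_mx A - Un1_mx B) (m * (m * (2 / N%:R))).
  exact: entry_opbound.
have : opbound (Un1_mx (B^-1 * A)%g - 1) r.
  apply: opboundW NK _.
  have -> : Un1_mx (B^-1 * A)%g - 1 = Un1_mx B^-1%g *m (Un1_mx A - Un1_mx B).
    by rewrite mulmxBr -!Un1_mxM mulVg.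
  apply: opboundM => //.
  by apply: le_trans (opbound_entry (rshift n 0) (rshift n 0) hB); exact: normc_ge0.
move=> /(hr _ Gfg); rewrite PUn1_piM PUn1_piV -fE -gE => E.
by rewrite -[RHS]mul1g -(mulgV g) -mulgA E mulg1.
Qed.

End Discreteness.

(** * The action on the boundary sphere *)

Section BoundaryAction.
Variables (R : realType) (n : nat).
Local Notation C := R[i].
Local Notation U := (Un1 R n).
Local Notation PU := (PUn1 R n).
Local Notation vec := 'cV[C]_(n + 1).
Local Notation cx := (real_complex R).
Local Notation near1 a x := (opbound (Un1_mx a - 1) x).

Lemma Un1_mxX (A : U) k : Un1_mx (A ^+ k)%g = Un1_mx A ^+ k.
Proof. by elim: k => [|k IH] //; rewrite expgS exprS Un1_mxM IH. Qed.

Lemma PUn1_piX (A : U) k : PUn1_pi (A ^+ k)%g = (PUn1_pi A ^+ k)%g.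
Proof. by elim: k => [|k IH] //; rewrite !expgS PUn1_piM IH. Qed.

Lemma Un1_phase (A : U) th : normc th = 1 ->
  exists2 B : U, Un1_mx B = th *: Un1_mx A & PUn1_pi B = PUn1_pi A.
Proof.
move=> th1; exists (mkUn1 (unitary_set_scale th1 (Un1P A))) => //.
apply/esym/PUn1_eqP; exists th => //; by rewrite normc_normr th1.
Qed.

Lemma lst_image_neq0 (A : U) z : sphere z -> lst (Un1_mx A *m lift_pt z) != 0.
Proof.
move=> /sphereP sz; apply: null_lst_neq0; first by rewrite Un1P.
apply/eqP => /(congr1 (mulmx (invmx (Un1_mx A)))).
rewrite mulKmx ?mulmx0; last exact/unitary_unitmx/Un1P.
by apply/eqP/lift_neq0.
Qed.

Lemma lift_act (A : U) z : sphere z -> lift_pt (act (PUn1_pi A) z) =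
  (lst (Un1_mx A *m lift_pt z))^-1 *: (Un1_mx A *m lift_pt z).
Proof. by move=> sz; rewrite act_pi lift_proj //; exact: lst_image_neq0. Qed.

Lemma act_sphere (f : PU) z : sphere z -> sphere (act f z).
Proof.
move=> sz; apply/sphereP; rewrite -[f]PUn1_reprK lift_act // hermZ Un1P.
by have /sphereP -> := sz; rewrite mulr0.
Qed.

Lemma act_sphereM (f g : PU) z : sphere z -> act (f * g)%g z = act f (act g z).
Proof.
move=> sz; rewrite -[f]PUn1_reprK -[g]PUn1_reprK -PUn1_piM.
set A := PUn1_repr f; set B := PUn1_repr g.
have c0 : (lst (Un1_mx B *m lift_pt z))^-1 != 0.
  by rewrite invr_eq0; exact: lst_image_neq0.
rewrite [RHS]act_pi (lift_act _ sz) -scalemxAr (proj_ptZ _ c0).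
by rewrite act_pi Un1_mxM mulmxA.
Qed.

Lemma fixes_act (A : U) z : sphere z ->
  fixes (Un1_mx A) z <-> act (PUn1_pi A) z = z.
Proof.
move=> sz; split => [[mu Az]|E].
  rewrite act_pi Az proj_ptZ ?proj_lift //.
  have := lst_image_neq0 A sz; rewrite Az lstZ lst_lift mulr1 //.
exists (lst (Un1_mx A *m lift_pt z)).
by rewrite -{3}E lift_act // scalerA divff ?scale1r ?lst_image_neq0.
Qed.

Definition boundary_fix (f : PU) : set 'cV[C]_n := Fix (@sphere R n) (@act R n) f.

(** The hyperbolic cosine of half the distance from [z] to its image. *)
Definition disp (A : U) (z : 'cV[C]_n) : R :=
  normc (herm (Un1_mx A *m lift_pt z) (lift_pt z)) / (1 - enorm z ^+ 2).

Lemma hyp_enorm (z : 'cV[C]_n) : hyp z <-> enorm z ^+ 2 < 1.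
Proof. by rewrite /hyp /= herm_lift_dot dotvv subr_lt0 -[1]/(cx 1) ltcR. Qed.

(** A frame [T] takes [base] to the line over [z]. Its norm explodes near the
    boundary, but only as fast as the scalar [a] tends to zero. *)
Lemma exists_frame (z : 'cV[C]_n) : hyp z -> exists (T : U) (K : R) (a : C),
  [/\ 0 <= K, opbound (Un1_mx T) K /\ opbound (Un1_mx T^-1%g) K,
   lift_pt z = a *: (Un1_mx T *m base R n) /\ normc a * K = 2 * enorm (lift_pt z)
   & forall A : U, disp A z = normc (lst (Un1_mx (T^-1 * A * T)%g *m base R n))].
Proof.
move=> /hyp_enorm hz; pose h := 1 - enorm z ^+ 2; have h0 : 0 < h by rewrite subr_gt0.
pose s := Num.sqrt h; have s0 : 0 < s by rewrite sqrtr_gt0.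
have sh : s ^+ 2 = h by rewrite sqr_sqrtr // ltW.
pose x := cx s^-1 *: lift_pt z.
have xx : herm x x = -1.
  rewrite hermZ mulc_conj normcR ger0_norm ?invr_ge0 ?(ltW s0) // exprVn sh.
  rewrite herm_lift_dot dotvv -[1]/(cx 1) -rmorphB -rmorphM /=.
  by rewrite -opprB mulrN mulVf ?gt_eqF // rmorphN.
have [T [uT [th th1 Tb] [hT hT']]] := unitary_transitive xx.
have th0 : th != 0 by rewrite -normc_eq0 th1 oner_eq0.
have cs0 : cx s != 0 by rewrite (inj_eq (@complexI R)) gt_eqF.
exists (mkUn1 uT), (2 * enorm x), (cx s * th^-1); split => //.
- by rewrite mulr_ge0 ?enorm_ge0.
- split; first by rewrite Tb !scalerA mulfVK // fmorphV /= divff // scale1r.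
  rewrite normcM normcV th1 invr1 mulr1 normcR ger0_norm ?(ltW s0) //.
  rewrite enormZ normcR ger0_norm ?invr_ge0 ?(ltW s0) //.
  by field; rewrite gt_eqF.
move=> A; rewrite -[RHS]normcN -herm_base !Un1_mxM Un1_mxV -mulmxA -mulmxA.
rewrite -[herm _ _ in RHS](Un1P (mkUn1 uT)) mulmxA mulmxV ?unitary_unitmx // mul1mx.
rewrite {1}Tb -scalemxAr Tb hermZ mulc_conj th1 expr1n /x -scalemxAr hermZ.
rewrite mulc_conj !normcM !normcR normr1 mul1r normrX normr_id.
rewrite ger0_norm ?invr_ge0 ?(ltW s0) //.
by rewrite exprVn sh /disp mulrC.
Qed.

Section Group.
Variable G : set PU.
Hypothesis G_subgroup : subgroup G.
Hypothesis G_discrete : discrete G.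
Hypothesis G_torsion_free : torsion_free G.

Lemma subgroupM f g : G f -> G g -> G (f * g)%g.
Proof.
move=> Gf Gg; apply: set_mem; apply: (group_closedM G_subgroup); exact: mem_set.
Qed.

Lemma subgroupV f : G f -> G f^-1%g.
Proof.
move=> Gf; apply: set_mem; apply: (group_closedV G_subgroup); exact: mem_set.
Qed.

(** An element with a fixed point in the ball is conjugate to a unitary map, so
    by Dirichlet some power of it is close to the identity, hence trivial. *)
Lemma discrete_no_negative (A : U) : G (PUn1_pi A) -> PUn1_pi A <> 1%g ->
  ~ has_negative_eigenvector (Un1_mx A).
Proof.
move=> GA A1 [v0 [mu [Av0 v0neg]]].
pose h := - complex.Re (herm v0 v0).
have vvE : herm v0 v0 = - cx h by rewrite /h rmorphN opprK hermvv.
have h0 : 0 < h by rewrite -ltcR -oppr_lt0 -vvE.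
pose x := cx (Num.sqrt h)^-1 *: v0.
have xx : herm x x = -1.
  rewrite hermZ mulc_conj normcR ger0_norm ?invr_ge0 ?sqrtr_ge0 // exprVn.
  by rewrite sqr_sqrtr ?ltW // vvE mulrN -rmorphM /= mulVf ?gt_eqF.
have Ax : Un1_mx A *m x = mu *: x by rewrite -scalemxAr Av0 !scalerA mulrC.
have mu1 : normc mu = 1.
  clearbody x; have := Un1P A x x; rewrite Ax hermZ xx mulc_conj mulrN1 => /oppr_inj.
  rewrite -[1]/(cx 1) => /complexI/eqP.
  by rewrite sqrf_eq1 => /orP[/eqP //|/eqP E]; have := normc_ge0 mu; rewrite E ler0N1.
clearbody x; have [T [uT [th th1 Tb] [hT hT']]] := unitary_transitive xx.
have Tu := unitary_unitmx uT.
have mu0 : mu != 0 by rewrite -normc_eq0 mu1 oner_eq0.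
have th0 : th != 0 by rewrite -normc_eq0 th1 oner_eq0.
set K := 2 * enorm x in hT hT'; have K0 : 0 <= K by rewrite mulr_ge0 ?enorm_ge0.
have muV : normc mu^-1 = 1 by rewrite normcV mu1 invr1.
pose W := mu^-1 *: (invmx T *m Un1_mx A *m T).
have uW : unitary_set W.
  apply: unitary_set_scale => //; apply: unitary_setM => //.
  by apply: unitary_setM; [exact: unitary_setV|exact: Un1P].
have Wb : W *m base R n = base R n.
  rewrite /W -scalemxAl -!mulmxA Tb -!scalemxAr Ax -!scalemxAr.
  have -> : invmx T *m x = th^-1 *: base R n.
    by rewrite -[x](scalerK th0) -Tb -scalemxAr mulKmx.
  rewrite !scalerA; set k := (X in X *: _).
  have -> : k = 1 by rewrite /k; field; rewrite mu0 th0.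
  exact: scale1r.
have [V uV WE] := stabilizer_block uW Wb.
have [l [l1 lk _]] := unitary_spectrum uV.
have [r r0 hr] := discrete_radius G_discrete.
pose N := Num.truncn (K * (63 / 10 * K) / r).
have [k [/andP[k0 _] kl]] := simultaneous_approximation N l1.
have muVk : normc (mu^-1 ^+ k) = 1 by rewrite normcX muV expr1n.
have [B BE piB] := Un1_phase (A ^+ k)%g muVk.
have M0 : 0 < N.+1%:R :> R by rewrite ltr0n.
have : near1 B r.
  have TW : mu^-1 *: Un1_mx A = T *m W *m invmx T.
    by rewrite -scalemxAr -scalemxAl !mulmxA mulmxV // mul1mx -mulmxA mulmxV // mulmx1.
  have -> : Un1_mx B = T *m W ^+ k *m invmx T.
    transitivity ((mu^-1 *: Un1_mx A) ^+ k); first by rewrite BE Un1_mxX exprZmx.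
    rewrite TW; elim: (k) => [|j IH].
      by rewrite !expr0 mulmx1 mulmxV.
    by rewrite !exprS IH -!mulmxE !mulmxA mulmxKV.
  have -> : T *m W ^+ k *m invmx T - 1 = T *m ((W ^+ k - 1) *m invmx T).
    by rewrite mulmxBl mul1mx mulmxBr mulmxV // mulmxA.
  apply: (@opboundW _ _ _ (K * (63 / 10 / N.+1%:R * K))).
    have := truncnS_gt (K * (63 / 10 * K) / r); rewrite -/N ltr_pdivrMr // => hN.
    rewrite -(ler_pM2r M0) [leRHS]mulrC (le_trans _ (ltW hN)) //.
    by rewrite le_eqVlt; apply/orP; left; apply/eqP; field; rewrite gt_eqF.
  have e0 : 0 <= 63 / 10 / N.+1%:R :> R by rewrite divr_ge0 // divr_ge0.
  apply: opboundM => //; apply: opboundM => //.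
  by rewrite WE block1_exp; apply: opbound_block1 => //; exact: lk.
have GB : G (PUn1_pi B).
  by rewrite piB PUn1_piX; apply: group_exp => //; exact: subgroupM.
by move=> /(hr _ GB); rewrite piB PUn1_piX; exact: G_torsion_free.
Qed.

Lemma boundary_fix_nonempty f : G f -> f <> 1%g -> exists z, boundary_fix f z.
Proof.
rewrite -[f]PUn1_reprK => Gf f1.
have [z sz fz] := exists_fixed (Un1P _) (discrete_no_negative Gf f1).
by exists z; split => //; apply/fixes_act.
Qed.

Lemma boundary_fix_le2 f : G f -> f <> 1%g -> forall x y z,
  boundary_fix f x -> boundary_fix f y -> boundary_fix f z -> [\/ x = y, y = z | x = z].
Proof.
rewrite -[f]PUn1_reprK => Gf f1 x y z [sx fx] [sy fy] [sz fz].
apply: contrapT => H; have [xy yz xz] : [/\ x <> y, y <> z & x <> z].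
  by split => E; apply: H; [constructor 1|constructor 2|constructor 3].
apply: (discrete_no_negative Gf f1).
by apply: (fixes_three (Un1P _) sx sy sz); rewrite ?fixes_act.
Qed.

Lemma boundary_fix_exp f k : G f -> f <> 1%g -> (0 < k)%N ->
  boundary_fix (f ^+ k)%g = boundary_fix f.
Proof.
exact: (@Fix_exp PU _ _ _ G (fun z _ => act1 z) act_sphereM act_sphere
  subgroupM G_torsion_free boundary_fix_nonempty boundary_fix_le2 f k).
Qed.

Lemma iter_commg_boundary_fix f g j : G f -> f <> 1%g -> G g -> g <> 1%g ->
  iter j (fun c => [~ f, c]%g) g = 1%g -> boundary_fix f `<=` boundary_fix g.
Proof.
exact: (@iter_commg_Fix PU _ _ _ G (fun z _ => act1 z) act_sphereM act_sphere
  subgroupM subgroupV G_torsion_free boundary_fix_nonempty boundary_fix_le2 f g j).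
Qed.

End Group.
End BoundaryAction.

(** * Elements with small displacement at the same point *)

Section SmallDisplacement.
Variables (R : realType) (n : nat).
Local Notation C := R[i].
Local Notation U := (Un1 R n).
Local Notation PU := (PUn1 R n).
Local Notation vec := 'cV[C]_(n + 1).
Local Notation cx := (real_complex R).
Local Notation near1 a x := (opbound (Un1_mx a - 1) x).

(** If [c] is the hyperbolic cosine of [d >= 0], then the left-hand side is [expR d]. *)
Lemma coshw_bound (c w : R) : 1 <= c -> 1 <= w -> c < (w + w^-1) / 2 ->
  c + Num.sqrt (c ^+ 2 - 1) <= w.
Proof.
move=> c1 w1 cw; have w0 : 0 < w by exact: lt_le_trans w1.
have wn : w != 0 by rewrite gt_eqF.
have w1' : w^-1 <= 1 by rewrite invf_le1.
have -> : w = (w + w^-1) / 2 + (w - w^-1) / 2 by field.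
apply: lerD; first exact: ltW.
have d0 : 0 <= (w - w^-1) / 2 by rewrite divr_ge0 // subr_ge0 (le_trans w1').
rewrite -[leRHS]ger0_norm // -sqrtr_sqr ler_wsqrtr //.
have -> : ((w - w^-1) / 2) ^+ 2 = ((w + w^-1) / 2) ^+ 2 - 1 by field.
have c0 : 0 <= c := le_trans ler01 c1.
by rewrite lerD2r lerXn2r ?nnegrE // ?(le_trans c0) // ltW.
Qed.

Lemma disp_frame (A T : U) z w : 1 <= w -> disp A z < (w + w^-1) / 2 ->
  disp A z = normc (lst (Un1_mx (T^-1 * A * T)%g *m base R n)) ->
  opbound (Un1_mx (T^-1 * A * T)%g) w.
Proof.
move=> w1 dw E; apply: opboundW (unitary_opbound (Un1P _) E erefl).
by apply: coshw_bound => //; rewrite E; apply: lst_base_ge1; exact: Un1P.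
Qed.

(** Both are the bound of [disp_frame]: the norm of the frame cancels against the
    scalar [a], and the multiplier is an eigenvalue of a conjugate of [A]. *)
Lemma disp_bounds (A : U) z w : hyp z -> 1 <= w -> disp A z < (w + w^-1) / 2 ->
  enorm (Un1_mx A *m lift_pt z) <= 2 * w * enorm (lift_pt z) /\
  forall (v : vec) mu, v != 0 -> Un1_mx A *m v = mu *: v -> normc mu <= w.
Proof.
move=> hz w1 dw; have [T [K [a [K0 [hT hT'] [zE aK] dE]]]] := exists_frame hz.
have hA := disp_frame w1 dw (dE A).
have Tu : Un1_mx T \in unitmx := unitary_unitmx (Un1P T).
have b1 : enorm (base R n) = 1.
  apply/eqP; rewrite -(@eqrXn2 _ 2) ?enorm_ge0 // sqr_enorm_col_mx enorm0 enorm_scalar.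
  by rewrite mxE normc_one expr1n expr0n add0r.
split.
  have -> : Un1_mx A *m lift_pt z =
      a *: (Un1_mx T *m (Un1_mx (T^-1 * A * T)%g *m base R n)).
    rewrite zE -scalemxAr; congr (_ *: _).
    by rewrite !mulmxA -!Un1_mxM -mulgA mulgA mulgV mul1g.
  rewrite enormZ.
  have h1 := hT (Un1_mx (T^-1 * A * T)%g *m base R n).
  have h2 := hA (base R n); rewrite b1 mulr1 in h2.
  have -> : 2 * w * enorm (lift_pt z) = normc a * (K * w) by rewrite mulrA aK; ring.
  by rewrite ler_wpM2l ?normc_ge0 // (le_trans h1) // ler_wpM2l.
move=> v mu v0 Av; apply: (eigenvalue_opbound hA (v := Un1_mx T^-1%g *m v)).
  apply: contra v0 => /eqP/(congr1 (mulmx (Un1_mx T))).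
  by rewrite mulmxA -Un1_mxM mulgV mul1mx mulmx0 => ->.
rewrite mulmxA -Un1_mxM -mulgA mulgV mulg1 Un1_mxM -mulmxA Av.
by rewrite -scalemxAr.
Qed.

Section Group.
Variable G : set PU.
Hypothesis n_gt0 : (0 < n)%N.
Hypothesis G_subgroup : subgroup G.
Hypothesis G_discrete : discrete G.
Hypothesis G_torsion_free : torsion_free G.
Variable w : R.
Hypothesis w_ge1 : 1 <= w.
Hypothesis w_pow : w ^+ (17 ^ (n - 1)) <= 100 / 99.

(** This is [near_identity_power] in the frame [T]; a boundary fixed point supplies
    the null eigenvector. *)
Lemma near_identity_element (A T : U) z :
  disp A z = normc (lst (Un1_mx (T^-1 * A * T)%g *m base R n)) ->
  G (PUn1_pi A) -> PUn1_pi A <> 1%g -> disp A z < (w + w^-1) / 2 ->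
  exists k a, [/\ (0 < k)%N, PUn1_pi (T * a * T^-1)%g = (PUn1_pi A ^+ k)%g,
    near1 a (63 / 170 + 1 / 99) & opbound (Un1_mx a^-1%g) (100 / 99)].
Proof.
move=> dE GA A1 dw; pose B : U := (T^-1 * A * T)%g.
have [p [sp fp]] := boundary_fix_nonempty G_subgroup G_discrete G_torsion_free GA A1.
have [mu Ap] := (fixes_act A sp).2 fp.
pose v := Un1_mx T^-1%g *m lift_pt p.
have v0 : v != 0.
  apply: contra (lift_neq0 p) => /eqP/(congr1 (mulmx (Un1_mx T))).
  by rewrite mulmxA -Un1_mxM mulgV mul1mx mulmx0 => ->.
have vv : herm v v = 0 by rewrite Un1P; apply/sphereP.
have Bv : Un1_mx B *m v = mu *: v.
  by rewrite mulmxA -Un1_mxM -mulgA mulgV mulg1 Un1_mxM -mulmxA Ap -scalemxAr.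
have cw := coshw_bound (lst_base_ge1 (Un1P B)) w_ge1.
rewrite -dE in cw.
have [k [th [k0 th1 h1 h3]]] :=
  near_identity_power n_gt0 (Un1P B) dE (cw dw) w_pow v0 vv Bv.
have [a aE pia] := Un1_phase (B ^+ k)%g th1.
exists k, a; split; first exact: k0.
- rewrite !PUn1_piM PUn1_piV pia PUn1_piX /B !PUn1_piM PUn1_piV.
  set t := PUn1_pi T; set f := PUn1_pi A.
  elim: (k) => [|j IH]; first by rewrite !expg0 mulg1 mulgV.
  by rewrite !expgS -IH !mulgA mulgV mul1g -!mulgA.
- by rewrite aE Un1_mxX.
- have -> : Un1_mx a^-1%g = th^-1 *: (invmx (Un1_mx B) ^+ k).
    have thu : th \is a GRing.unit by rewrite unitfE -normc_eq0 th1 oner_eq0.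
    have uB := unitary_unitmx (Un1P (B ^+ k)%g).
    rewrite Un1_mxV aE invmxZ; last by rewrite -aE; exact: unitary_unitmx (Un1P a).
    have -> : invmx (Un1_mx (B ^+ k)%g) = Un1_mx (B^-1 ^+ k)%g by rewrite expVgn.
    by rewrite Un1_mxX.
  have thV : normc th^-1 = 1 by rewrite normcV th1 invr1.
  by have := opboundZ th^-1 h3; rewrite thV mul1r.
Qed.

(** Powers of [A] and [B] are close to the identity in a frame at [z], and their
    iterated commutators become trivial. *)
Lemma small_disp_boundary_fix_sub (A B : U) z : hyp z ->
  G (PUn1_pi A) -> PUn1_pi A <> 1%g -> disp A z < (w + w^-1) / 2 ->
  G (PUn1_pi B) -> PUn1_pi B <> 1%g -> disp B z < (w + w^-1) / 2 ->
  boundary_fix (PUn1_pi A) `<=` boundary_fix (PUn1_pi B).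
Proof.
move=> hz GA A1 dA GB B1 dB.
have [T [K [_ [K0 [hT hT'] _ dE]]]] := exists_frame hz.
have [k [a [k0 ak ha hia]]] := near_identity_element (dE A) GA A1 dA.
have [m [b [m0 bm hb hib]]] := near_identity_element (dE B) GB B1 dB.
have [r r0 hr] := discrete_radius G_discrete.
have K1 : 0 < K + 1 by rewrite ltr_wpDl.
(* With these constants the ratio of contraction is about [0.9965]. *)
have [||||j hj] := iter_commg_cvg1 _ _ _ ha hb hia hib (r := r / (K + 1) ^+ 2).
- by lra.
- by lra.
- by lra.
- by rewrite divr_gt0 // exprn_gt0.
pose h (c : U) : PU := PUn1_pi (T * c * T^-1)%g.
have hM c d : h (c * d)%g = (h c * h d)%g.
  by rewrite /h -PUn1_piM !mulgA mulgVK.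
have hV c : h c^-1%g = (h c)^-1%g.
  by rewrite /h -PUn1_piV !invgM invgK mulgA.
have hR c d : h [~ c, d]%g = [~ h c, h d]%g.
  by rewrite !commgEl /conjg !hM !hV.
have hiter i : h (iter i (fun c => [~ a, c]%g) b) =
    iter i (fun c => [~ h a, c]%g) (h b).
  by elim: i => //= i <-; exact: hR.
have Ghc : G (h (iter j (fun c => [~ a, c]%g) b)).
  have GMs := subgroupM G_subgroup; have GVs := subgroupV G_subgroup.
  rewrite hiter; have Gha : G (h a) by rewrite /h ak; exact: group_exp GMs _ _ GA k0.
  have Ghb : G (h b) by rewrite /h bm; exact: group_exp GMs _ _ GB m0.
  elim: (j) => //= i IH.
  rewrite commgEl /conjg; apply: (GMs); first exact: GVs.
  by apply: (GMs); [exact: GVs|exact: GMs].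
have : near1 (T * iter j (fun c => [~ a, c]%g) b * T^-1)%g r.
  set c := iter _ _ _ in hj *.
  have -> : Un1_mx (T * c * T^-1)%g - 1 = Un1_mx T *m ((Un1_mx c - 1) *m Un1_mx T^-1%g).
    by rewrite mulmxBl mul1mx mulmxBr -!Un1_mxM mulgV mulgA.
  apply: (@opboundW _ _ _ (K * (r / (K + 1) ^+ 2 * K))).
    have rE : (K + 1) * (r / (K + 1) ^+ 2 * (K + 1)) = r by field; rewrite gt_eqF.
    have r1 : 0 <= r / (K + 1) ^+ 2 by rewrite divr_ge0 ?ltW // exprn_gt0.
    have KK : K <= K + 1 by rewrite lerDl.
    rewrite -[leRHS]rE; apply: ler_pM => //; first exact: mulr_ge0.
    by apply: ler_wpM2l.
  apply: opboundM => //; apply: opboundM => //.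
  by rewrite divr_ge0 ?ltW // exprn_gt0.
move=> /(hr _ Ghc) E.
rewrite -(boundary_fix_exp G_subgroup G_discrete G_torsion_free GA A1 k0).
rewrite -(boundary_fix_exp G_subgroup G_discrete G_torsion_free GB B1 m0).
apply: (iter_commg_boundary_fix G_subgroup G_discrete G_torsion_free (j := j)).
- exact: group_exp (subgroupM G_subgroup) _ _ GA k0.
- exact: G_torsion_free.
- exact: group_exp (subgroupM G_subgroup) _ _ GB m0.
- exact: G_torsion_free.
- rewrite -ak -bm -[PUn1_pi (T * a * _)%g]/(h a).
  by rewrite -[PUn1_pi (T * b * _)%g]/(h b) -hiter.
Qed.

Lemma small_disp_boundary_fix (A B : U) z : hyp z ->
  G (PUn1_pi A) -> PUn1_pi A <> 1%g -> disp A z < (w + w^-1) / 2 ->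
  G (PUn1_pi B) -> PUn1_pi B <> 1%g -> disp B z < (w + w^-1) / 2 ->
  boundary_fix (PUn1_pi A) = boundary_fix (PUn1_pi B).
Proof.
move=> hz GA A1 dA GB B1 dB.
by apply/seteqP; split; apply: (@small_disp_boundary_fix_sub _ _ z).
Qed.

End Group.
End SmallDisplacement.

(** * Displacement and norm *)

Section DisplacementNorm.
Variables (R : realType) (n : nat).
Local Notation C := R[i].
Local Notation U := (Un1 R n).
Local Notation PU := (PUn1 R n).
Local Notation vec := 'cV[C]_(n + 1).
Local Notation cx := (real_complex R).

Lemma coshN (t : R) : cosh t = (expR t + (expR t)^-1) / 2.
Proof. by rewrite /cosh expRN. Qed.

Lemma cosh_gt0 (t : R) : 0 < cosh t.
Proof. by rewrite /cosh divr_gt0 // addr_gt0 // expR_gt0. Qed.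

Lemma cosh_lt (t u : R) : 0 <= t -> t < u -> cosh t < cosh u.
Proof.
move=> t0 tu; rewrite !coshN ltr_pM2r ?invr_gt0 // -subr_gt0.
set x := expR t; set y := expR u.
have x1 : 1 <= x by rewrite -expR0 ler_expR.
have xy : x < y by rewrite ltr_expR.
have x0 : 0 < x by exact: lt_le_trans x1.
have y0 : 0 < y by exact: lt_trans xy.
have -> : y + y^-1 - (x + x^-1) = (y - x) * (x * y - 1) / (x * y).
  by field; rewrite !gt_eqF.
rewrite divr_gt0 ?mulr_gt0 // ?subr_gt0 //.
by rewrite (le_lt_trans x1) // ltr_pMr // (le_lt_trans x1).
Qed.

Lemma cosh_bergman (A : U) z : hyp z ->
  cosh (bergman z (act (PUn1_pi A) z) / 2) = disp A z.
Proof.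
move=> hz; have hAz := act_hyp (PUn1_pi A) hz.
have [_] := bergmanP hz hAz; rewrite act_pi lift_proj; last exact: unitary_lift_neq0.
rewrite -[lift_pt z in X in herm_ratio X _]scale1r herm_ratioZ ?oner_eq0 //; last first.
  by rewrite invr_eq0; exact: unitary_lift_neq0.
rewrite /herm_ratio (Un1P A) -(herm_conj (Un1_mx A *m _)) [_^* * _]mulrC mulc_conj.
have -> : herm (lift_pt z) (lift_pt z) = cx (enorm z ^+ 2 - 1).
  by rewrite herm_lift_dot dotvv rmorphB.
have /hyp_enorm hz1 := hz.
have h0 : 0 < 1 - enorm z ^+ 2 by rewrite subr_gt0.
rewrite -rmorphM -fmorphV -rmorphM /= => /complexI E.
apply/eqP; rewrite -(@eqrXn2 _ 2) ?(ltW (cosh_gt0 _)) //; last first.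
  by rewrite divr_ge0 ?normc_ge0 ?ltW.
rewrite E /disp; apply/eqP; set y := enorm z ^+ 2 in h0 *.
have n1 : y - 1 != 0 by rewrite lt_eqF // subr_lt0.
have n2 : 1 - y != 0 by rewrite gt_eqF.
by field; rewrite ?n1 ?n2.
Qed.

(** A bound on an isometry [A] in terms of a null eigenvector [v] and the image
    of a vector [y] that is not orthogonal to [v]: a combination of the two is
    a negative vector, moved boundedly. *)
Lemma unitary_bounded (A : U) (v y : vec) mu (w k : R) :
  herm v v = 0 -> 0 <= normc (lst y) ^+ 2 - enorm (usubmx y) ^+ 2 ->
  0 < k -> k <= normc (herm y v) -> enorm v <= 2 -> enorm y <= 2 ->
  Un1_mx A *m v = mu *: v -> 0 <= w -> normc mu <= w ->
  enorm (Un1_mx A *m y) <= 4 * w ->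
  let M := 2 / k + 2 in let K := 4 * (w * M) * (2 * M) in
  opbound (Un1_mx A) K /\ opbound (Un1_mx A^-1%g) K.
Proof.
move=> vv yy k0 ky v2 y2 Av w0 muw Ay M K.
have [kap kapE] : exists kap, herm y v = kap by exists (herm y v).
rewrite kapE in ky; have kap0 : 0 < normc kap by exact: lt_le_trans ky.
have kapn : kap != 0 by rewrite -normc_eq0 gt_eqF.
(* With this coefficient the two cross terms of [herm x x] add up to [-2]. *)
pose be := - (kap^*)^-1; pose x := be *: v + y.
have kapc : kap^* != 0 by rewrite conjC_eq0.
pose g : R := 2 + (normc (lst y) ^+ 2 - enorm (usubmx y) ^+ 2).
have g1 : 1 <= g by rewrite /g; lra.
have xx : herm x x = - cx g.
  rewrite hermDl !hermDr !hermZl !hermZr vv -(herm_conj y v) kapE hermvv.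
  have -> : be^* = - kap^-1 by rewrite /be rmorphN fmorphV /= conjCK.
  rewrite /be /g -[enorm _ ^+ 2 - _]opprB.
  move: (normc (lst y) ^+ 2 - _) => q.
  have -> : cx (2 + q) = 2 + cx q by rewrite rmorphD rmorph_nat.
  rewrite rmorphN /=; field.
  by rewrite kapc kapn.
have be_le : normc be <= k^-1.
  by rewrite normcN normcV normc_conj lef_pV2 ?posrE.
have Mk : k^-1 * 2 + 2 = M by rewrite mulrC.
have xM : enorm x <= M.
  apply: le_trans (enormD _ _) _; rewrite enormZ -Mk lerD //.
  by apply: ler_pM => //; [exact: normc_ge0|exact: enorm_ge0].
have AxM : enorm (Un1_mx A *m x) <= 2 * (w * M).
  rewrite mulmxDr -scalemxAr Av; apply: le_trans (enormD _ _) _.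
  have -> : 2 * (w * M) = k^-1 * (w * 2) + k^-1 * (w * 2) + 4 * w by rewrite -Mk; ring.
  apply: lerD => //; rewrite !enormZ.
  apply: (@le_trans _ _ (k^-1 * (w * 2))); last first.
    by rewrite lerDl mulr_ge0 ?invr_ge0 ?mulr_ge0 // ltW.
  apply: ler_pM => //; rewrite ?mulr_ge0 ?normc_ge0 ?enorm_ge0 //.
  by apply: ler_pM => //; [exact: normc_ge0|exact: enorm_ge0].
have g0 : 0 < g by exact: lt_le_trans g1.
pose s := (Num.sqrt g)^-1; have s0 : 0 <= s by rewrite invr_ge0 sqrtr_ge0.
have s1 : s <= 1 by rewrite invf_le1 ?sqrtr_gt0 // -sqrtr1 ler_wsqrtr.
pose x1 := cx s *: x.
have x1x1 : herm x1 x1 = -1.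
  rewrite hermZ mulc_conj normcR ger0_norm // exprVn sqr_sqrtr ?ltW // xx.
  by rewrite mulrN -rmorphM /= mulVf ?gt_eqF.
have sle (u : vec) b : enorm u <= b -> enorm (cx s *: u) <= b.
  move=> ub; rewrite enormZ normcR ger0_norm // (le_trans _ ub) //.
  by rewrite ler_piMl // enorm_ge0.
have x1M := sle _ _ xM.
have [T [uT [th th1 Tb] [hT hT']]] := unitary_transitive x1x1.
have M0 : 0 <= M by rewrite addr_ge0 // divr_ge0 // ltW.
have {}hT : opbound T (2 * M) by apply: opboundW hT; rewrite ler_wpM2l.
have {}hT' : opbound (invmx T) (2 * M) by apply: opboundW hT'; rewrite ler_wpM2l.
pose B : U := (A * mkUn1 uT)%g.
have Bl : 2 * normc (lst (Un1_mx B *m base R n)) <= 4 * (w * M).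
  have -> : 4 * (w * M) = 2 * (2 * (w * M)) by ring.
  rewrite ler_wpM2l // Un1_mxM -mulmxA Tb -scalemxAr lstZ normcM th1 mul1r.
  by apply: le_trans (normc_le_enorm _ _) _; rewrite -scalemxAr; exact: sle.
have hB : opbound (Un1_mx B) (4 * (w * M)).
  by apply: opboundW Bl _; apply: unitary_opbound_base; exact: Un1P.
have hB' : opbound (Un1_mx B^-1%g) (4 * (w * M)).
  apply: opboundW Bl _; rewrite -lst_base_inv; last exact: Un1P.
  by apply: unitary_opbound_base; exact: Un1P.
have wM : 0 <= 4 * (w * M) by rewrite !mulr_ge0.
have M2 : 0 <= 2 * M by rewrite mulr_ge0.
split.
  have -> : A = (B * (mkUn1 uT)^-1)%g by rewrite /B -mulgA mulgV mulg1.
  by rewrite Un1_mxM; exact: opboundM.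
have -> : (A^-1 = mkUn1 uT * B^-1)%g by rewrite /B invgM mulgA mulgV mul1g.
by rewrite Un1_mxM /K mulrC; exact: opboundM.
Qed.

End DisplacementNorm.

(** * Continuation along an interval *)

Section Continuation.
Variable R : realType.
Local Notation C := R[i].
Local Notation cx := (real_complex R).

Lemma normc_quadratic_continuous (a b c : C) :
  continuous (fun t : R => normc (a + cx t * b + cx t ^+ 2 * c)).
Proof.
case: a b c => [a1 a2] [b1 b2] [c1 c2].
have -> : (fun t : R => normc ((a1 +i* a2)%C + cx t * (b1 +i* b2)%C
      + cx t ^+ 2 * (c1 +i* c2)%C)) =
    (fun t : R => Num.sqrt (
      (a1 + t * b1 + t * (t * c1)) * (a1 + t * b1 + t * (t * c1)) +
      (a2 + t * b2 + t * (t * c2)) * (a2 + t * b2 + t * (t * c2)))).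
  apply/funext => t; rewrite /normc expr2 -rmorphM /=; congr Num.sqrt; ring.
have lin (x y z : R) : continuous (fun t : R => x + t * y + t * (t * z)).
  move=> t; apply: cvgD.
    apply: cvgD; first exact: cvg_cst.
    by apply: cvgM; [exact: cvg_id|exact: cvg_cst].
  by apply: cvgM; [exact: cvg_id|apply: cvgM; [exact: cvg_id|exact: cvg_cst]].
move=> t; apply: continuous_comp; last exact: sqrt_continuous.
by apply: cvgD; apply: cvgM; exact: lin.
Qed.

(** The points where some [phi a] with the label of [a0] is positive form a set that
    is open and closed in the interval. *)
Lemma cover_constant (T X : Type) (phi : T -> R -> R) (lab : T -> X) :
  (forall a, continuous (phi a)) ->
  (forall t, 0 <= t < 1 -> exists a, 0 < phi a t) ->
  (forall a b t, 0 <= t < 1 -> 0 < phi a t -> 0 < phi b t -> lab a = lab b) ->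
  forall a0 a t, 0 < phi a0 0 -> 0 <= t < 1 -> 0 < phi a t -> lab a = lab a0.
Proof.
move=> cphi cover agree a0 a t pa0 t01 pat.
pose I := [set` `[0, 1[%R] : set R.
have IE s : I s = (0 <= s < 1 :> bool) by rewrite /I /= in_itv.
pose S (L : set T) := \bigcup_(b in L) [set s | 0 < phi b s].
have Sopen L : open (S L).
  apply: bigcup_open => b _.
  apply: (@open_comp _ _ (phi b) [set x | 0 < x]); last exact: open_gt.
  by move=> s _; exact: cphi.
pose B := I `&` S [set b | lab b = lab a0].
have BI : B = I.
  have /connected_intervalP : is_interval I by exact: interval_is_interval.
  apply.
  - by exists 0; split; [rewrite IE lexx ltr01|exists a0].
  - by exists (S [set b | lab b = lab a0]).
  - exists (~` S [set b | lab b <> lab a0]); first exact/open_closedC/Sopen.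
    apply/seteqP; split=> s [Is].
      move=> [b bl pb]; split => // -[b' b'l pb'].
      by apply: b'l; rewrite -bl; apply: (agree _ _ s); rewrite -?IE.
    move=> nS; split=> //; have [b pb] := cover s ltac:(by rewrite -IE).
    exists b => //=; apply: contrapT => bl; apply: nS; by exists b.
have : B t by rewrite BI IE.
by move=> [_ [b <- pb]]; exact: (agree _ _ t).
Qed.

End Continuation.

(** * Displacement along a ray *)

Section RayMargins.
Variables (R : realType) (n : nat).
Local Notation C := R[i].
Local Notation U := (Un1 R n).
Local Notation cx := (real_complex R).

(** Positive exactly when the displacement of [A] at the point [t *: xi] of a
    ray is less than [c]; unlike [disp] it is continuous up to the boundary
    point [t = 1]. *)
Definition margin (c : R) (xi : 'cV[C]_n) (A : U) (t : R) : R :=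
  c * (1 - t ^+ 2) -
  normc (herm (Un1_mx A *m lift_pt (cx t *: xi)) (lift_pt (cx t *: xi))).

Lemma margin_continuous c xi A : continuous (margin c xi A).
Proof.
pose v : 'cV[C]_(n + 1) := col_mx xi 0; pose b := base R n.
have liftE t : lift_pt (cx t *: xi) = b + cx t *: v.
  by rewrite /lift_pt /b /base /v scale_col_mx add_col_mx add0r scaler0 addr0.
pose M := Un1_mx A.
have -> : margin c xi A = (fun t => c * (1 - t ^+ 2) -
    normc (herm (M *m b) b + cx t * (herm (M *m v) b + herm (M *m b) v)
           + cx t ^+ 2 * herm (M *m v) v)).
  apply/funext => t; rewrite /margin liftE mulmxDr -scalemxAr.
  rewrite !(hermDl, hermDr, hermZl, hermZr) conjR; congr (_ - normc _).
  move: (herm (M *m b) b) (herm (M *m v) b) (herm (M *m b) v) => h1 h2 h3.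
  move: (herm (M *m v) v) => h4; ring.
move=> t; apply: cvgD; last by apply: cvgN; exact: normc_quadratic_continuous.
apply: cvgM; first exact: cvg_cst.
apply: cvgD; first exact: cvg_cst.
by apply: cvgN; apply: cvgM; exact: cvg_id.
Qed.

Lemma sphere_ray (xi : 'cV[C]_n) (t : R) :
  sphere xi -> 0 <= t -> enorm (cx t *: xi) = t.
Proof. by move=> sx t0; rewrite enormZ normcR ger0_norm // sx mulr1. Qed.

Lemma hyp_ray (xi : 'cV[C]_n) (t : R) : sphere xi -> 0 <= t < 1 -> hyp (cx t *: xi).
Proof.
move=> sx /andP[t0 t1]; apply/hyp_enorm; rewrite sphere_ray //.
by rewrite exprn_ilt1.
Qed.

Lemma margin_disp c xi A t : sphere xi -> 0 <= t < 1 ->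
  (0 < margin c xi A t) = (disp A (cx t *: xi) < c).
Proof.
move=> sx t01; have /hyp_enorm := hyp_ray sx t01.
have /andP[t0 _] := t01; rewrite sphere_ray // => h.
by rewrite /margin /disp sphere_ray // subr_gt0 ltr_pdivrMr ?subr_gt0.
Qed.

(** At [t = 1] only the product of two null vectors remains, and they span
    different lines. *)
Lemma margin_boundary c xi A : sphere xi -> ~ boundary_fix (PUn1_pi A) xi ->
  margin c xi A 1 < 0.
Proof.
move=> sx nfix; rewrite /margin scale1r expr1n subrr mulr0 sub0r oppr_lt0.
rewrite lt_def normc_ge0 andbT normc_eq0.
have := sphere_herm_neq0 (act_sphere (PUn1_pi A) sx) sx _.
rewrite lift_act // hermZl mulf_eq0 invr_eq0 (negPf (lst_image_neq0 A sx)) /=.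
by apply => E; apply: nfix.
Qed.

Lemma margin_pi c xi (A B : U) t : PUn1_pi A = PUn1_pi B ->
  margin c xi A t = margin c xi B t.
Proof.
move=> /PUn1_eqP[th]; rewrite normc_normr -[1]/(cx 1) => /complexI th1 E.
by rewrite /margin E -scalemxAl hermZl normcM th1 mul1r.
Qed.

Lemma three_sphere_points : (0 < n)%N -> exists x y z : 'cV[C]_n,
  [/\ sphere x, sphere y, sphere z & [/\ x <> y, y <> z & x <> z]].
Proof.
move=> n0; pose e : 'cV[C]_n := delta_mx (Ordinal n0) 0.
have e1 : enorm e = 1.
  apply/eqP; rewrite -(@eqrXn2 _ 2) ?enorm_ge0 // sqr_enorm.
  rewrite (bigD1 (Ordinal n0)) //= big1 => [|k /negPf kj]; rewrite !mxE ?eqxx /=.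
    by rewrite addr0 normc_one.
  by rewrite kj normc_zero expr0n.
have sph a : normc a = 1 -> sphere (a *: e) by rewrite /sphere enormZ e1 mulr1.
have inj a b : a *: e = b *: e -> a = b.
  by move=> /matrixP/(_ (Ordinal n0) 0); rewrite !mxE !eqxx !mulr1.
have ni : normc ('i : C)%C = 1.
  by rewrite /normc expr0n expr1n add0r sqrtr1.
exists (1 *: e), (- 1 *: e), ('i%C *: e); split.
- by apply: sph; rewrite normc_one.
- by apply: sph; rewrite normcN normc_one.
- exact: sph.
have two0 : (1 : R) <> -1 by move=> /eqP; rewrite -subr_eq0 opprK (pnatr_eq0 R 2).
split => /inj /eqP; rewrite eq_complex /= => /andP[/eqP h1 /eqP h2].
- by apply: two0.
- by move/eqP: h2; rewrite oppr0 eq_sym oner_eq0.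
- by move/eqP: h2; rewrite eq_sym oner_eq0.
Qed.

(** The point of the ray and the fixed point [p] supply the two vectors of
    [unitary_bounded]. Their product has a nonzero limit as [t] tends to 1, half
    of which is a lower bound near 1. *)
Lemma margin_bounded (w : R) (xi p : 'cV[C]_n) : 1 <= w ->
  sphere xi -> sphere p -> p <> xi ->
  exists e K : R, 0 < e /\ forall (A : U) t, 0 <= t < 1 -> 1 - t <= e ->
    boundary_fix (PUn1_pi A) p -> 0 < margin ((w + w^-1) / 2) xi A t ->
    opbound (Un1_mx A) K /\ opbound (Un1_mx A^-1%g) K.
Proof.
move=> w1 sx sp pxi; have w0 : 0 <= w := le_trans ler01 w1.
have := sphere_herm_neq0 sx sp (fun h => pxi (esym h)).
set k1 := herm _ _ => k1n; pose k := normc k1 / 2.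
have k0 : 0 < k by rewrite divr_gt0 // lt_def normc_eq0 k1n normc_ge0.
exists k; eexists; split=> // A t t01 tk [_ fp] mt.
have /andP[t0 t1] := t01; have hz := hyp_ray sx t01.
move: mt; rewrite margin_disp // => dA.
have [h1 h2] := disp_bounds hz w1 dA.
have [mu Ap] := (fixes_act A sp).2 fp.
have lift2 (u : 'cV[C]_n) : enorm u <= 1 -> enorm (lift_pt u) <= 2.
  move=> u1; rewrite -ler_sqr ?nnegrE ?enorm_ge0 // sqr_enorm_col_mx enorm_scalar mxE.
  have : enorm u ^+ 2 <= 1 by rewrite exprn_ile1 ?enorm_ge0.
  by rewrite normc_one; lra.
have y2 : enorm (lift_pt (cx t *: xi)) <= 2.
  by apply: lift2; rewrite sphere_ray // ltW.
apply: (unitary_bounded (v := lift_pt p) (y := lift_pt (cx t *: xi)) (mu := mu)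
  (w := w) (k := k)) => //.
- exact/sphereP.
- rewrite col_mxKu lst_lift normc_one expr1n sphere_ray // subr_ge0.
  by rewrite exprn_ile1 // ltW.
- rewrite herm_lift_dot dotZl; have k1E : dot xi p = k1 + 1.
    by rewrite /k1 herm_lift_dot subrK.
  have dle : normc (dot xi p) <= 1.
    by apply: le_trans (CauchySchwarz_dot _ _) _; rewrite sx sp mulr1.
  have -> : cx t * dot xi p - 1 = k1 - cx (1 - t) * dot xi p.
    by rewrite rmorphB /= -[cx 1]/(1 : C) k1E; ring.
  have := normcB (k1 - cx (1 - t) * dot xi p) (- (cx (1 - t) * dot xi p)).
  rewrite opprK subrK normcN normcM normcR ger0_norm ?subr_ge0 ?(ltW t1) //.
  have : (1 - t) * normc (dot xi p) <= k.
    by apply: le_trans tk; rewrite ler_piMr // subr_ge0 (ltW t1).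
  by rewrite /k; lra.
- by apply: lift2; rewrite sp.
- exact: h2 (lift_neq0 p) Ap.
- apply: le_trans h1 _; have : w * enorm (lift_pt (cx t *: xi)) <= w * 2.
    by rewrite ler_wpM2l.
  lra.
Qed.

End RayMargins.

(** * A point moved far by every element *)

Theorem theorem4p1 (R : realType) (n : nat) (n_ge1 : (1 <= n)%N)
    (G : set (PUn1 R n))
    (G_subgroup : subgroup G) (G_discrete : discrete G)
    (G_torsion_free : torsion_free G)
    (x : 'cV[R[i]]_n) (x_hyp : hyp x)
    (G_non_elementary : ~ elementary G x) :
  exists o : 'cV[R[i]]_n, hyp o /\
    forall f : PUn1 R n, G f -> f <> 1%g ->
      bergman o (act f o) >= (2 / 100) / 17 ^+ (n - 1).
Proof.
apply: contrapT => H.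
pose delta : R := (2 / 100) / 17 ^+ (n - 1).
have pow0 : 0 < 17 ^+ (n - 1) :> R by rewrite exprn_gt0.
have delta0 : 0 <= delta by rewrite divr_ge0 ?ltW.
(* A displacement less than [delta] means [disp] less than [(w + w^-1) / 2]. *)
pose w := expR (delta / 2).
have w1 : 1 <= w by rewrite -expR0 ler_expR divr_ge0.
have w_pow : w ^+ (17 ^ (n - 1)) <= 100 / 99.
  rewrite /w -expRM_natl.
  have -> : (17 ^ (n - 1))%:R * (delta / 2) = 1 / 100.
    by rewrite natrX /delta; field; rewrite gt_eqF.
  have := expR_ge1Dx (- (1 / 100) : R); rewrite expRN => h.
  have e0 := expR_gt0 (1 / 100 : R).
  move: h => /(ler_wpM2r (ltW e0)); rewrite mulVf ?gt_eqF //; lra.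
pose c := (w + w^-1) / 2.
have move_all z : hyp z -> exists A : Un1 R n,
    [/\ G (PUn1_pi A), PUn1_pi A <> 1%g & disp A z < c].
  move=> hz; apply: contrapT => N; apply: H; exists z; split => // f Gf f1.
  rewrite leNgt; apply/negP => lt; apply: N; exists (PUn1_repr f).
  rewrite PUn1_reprK; split => //.
  rewrite -cosh_bergman // PUn1_reprK /c -coshN.
  have [b0 _] := bergmanP hz (act_hyp f hz).
  by apply: cosh_lt; rewrite ?divr_ge0 // ltr_pM2r ?invr_gt0.
have h0 : hyp (0 : 'cV[R[i]]_n).
  by apply/hyp_enorm; rewrite enorm0 expr0n ltr01.
have [A0 [GA0 A01 dA0]] := move_all 0 h0.
have [p Fp] := boundary_fix_nonempty G_subgroup G_discrete G_torsion_free GA0 A01.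
have [xi sx nxi] : exists2 xi, sphere xi & ~ boundary_fix (PUn1_pi A0) xi.
  have [a [b [d [sa sb sd [ab bd ad]]]]] := three_sphere_points R n_ge1.
  apply: contrapT => N.
  have all y : sphere y -> boundary_fix (PUn1_pi A0) y.
    by move=> sy; apply: contrapT => ny; apply: N; exists y.
  by have [] := boundary_fix_le2 G_subgroup G_discrete G_torsion_free GA0 A01
    (all _ sa) (all _ sb) (all _ sd).
have pxi : p <> xi by move=> E; apply: nxi; rewrite -E.
pose T := {A : Un1 R n | G (PUn1_pi A) /\ PUn1_pi A <> 1%g}.
have same A t : 0 <= t < 1 -> G (PUn1_pi A) -> PUn1_pi A <> 1%g ->
    0 < margin c xi A t -> boundary_fix (PUn1_pi A) = boundary_fix (PUn1_pi A0).
  move=> t01 GA A1 mA.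
  apply: (@cover_constant R T _ (fun B => margin c xi (sval B))
    (fun B => boundary_fix (PUn1_pi (sval B))) _ _ _ (exist _ A0 (conj GA0 A01))
    (exist _ A (conj GA A1)) t).
  - by move=> B; exact: margin_continuous.
  - move=> s s01; have [B [GB B1 dB]] := move_all _ (hyp_ray sx s01).
    exists (exist _ B (conj GB B1)); rewrite (margin_disp _ _ sx s01); exact: dB.
  - move=> [B [GB B1]] [D [GD D1]] s s01; rewrite !(margin_disp _ _ sx s01) => dB dD.
    exact: (small_disp_boundary_fix n_ge1 G_subgroup G_discrete G_torsion_free w1 w_pow
      (hyp_ray sx s01) GB B1 dB GD D1 dD).
  - have s01 : 0 <= (0 : R) < 1 by rewrite lexx ltr01.
    by rewrite (margin_disp _ _ sx s01) scale0r; exact: dA0.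
  - exact: t01.
  - exact: mA.
have [e [K [e0 hK]]] := margin_bounded w1 sx Fp.1 pxi.
have /finite_seqP[l SE] := @bounded_finite R n G K G_subgroup G_discrete.
have : nbhs (1 : R) [set t | forall f, f \in l ->
    boundary_fix f = boundary_fix (PUn1_pi A0) -> margin c xi (PUn1_repr f) t < 0].
  elim: l {SE} => [|f l IH]; first by apply: filterE.
  have [Ff|nF] := pselect (boundary_fix f = boundary_fix (PUn1_pi A0)); last first.
    by apply: filterS IH => t IH g; rewrite inE => /orP[/eqP -> /nF|/IH].
  have m1 : margin c xi (PUn1_repr f) 1 < 0.
    by apply: (margin_boundary c sx); rewrite PUn1_reprK Ff.
  have near1 : nbhs (1 : R) [set t | margin c xi (PUn1_repr f) t < 0].
    apply: (@margin_continuous R n c xi (PUn1_repr f) 1 [set y | y < 0]).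
    by apply: open_nbhs_nbhs; split; [exact: open_lt|].
  apply: (@filterS _ (nbhs (1 : R)) _ _ _ _ (filterI near1 IH)) => t [/= mt {}IH] g.
  by rewrite inE => /orP[/eqP ->|/IH].
move=> /nbhs_ballP[r /= r0 hr].
(* The point [t] is close enough to 1 for all the candidates at once. *)
pose s := Num.min 1 (Num.min e (r / 2)); pose t := 1 - s.
have s0 : 0 < s by rewrite !lt_min ltr01 e0 divr_gt0.
have [s1 se sr] : [/\ s <= 1, s <= e & s <= r / 2].
  by split; rewrite /s !ge_min lexx ?orbT.
have t01 : 0 <= t < 1 by rewrite /t; apply/andP; split; lra.
have [A [GA A1 dA]] := move_all _ (hyp_ray sx t01).
have mA : 0 < margin c xi A t by rewrite margin_disp.
have FA := same A t t01 GA A1 mA.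
have [bA bA'] : opbound (Un1_mx A) K /\ opbound (Un1_mx A^-1%g) K.
  have te : 1 - t <= e by rewrite /t opprB addrC subrK.
  by apply: (hK A t t01 te _ mA); rewrite FA.
have ht : ball (1 : R) r t.
  by rewrite -ball_normE /ball_ /= /t opprB addrC subrK gtr0_norm //; lra.
have Al : PUn1_pi A \in l.
  suff : [set` l] (PUn1_pi A) by [].
  by rewrite -SE; exists A.
have := hr _ ht _ Al FA.
have -> : margin c xi (PUn1_repr (PUn1_pi A)) t = margin c xi A t.
  by apply: margin_pi; rewrite PUn1_reprK.
by move=> /(lt_trans mA); rewrite ltxx.
Qed.
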